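(* Let $D$ be a syntactical data type (a type that is both an input type and an output type) of system $\mathcal F$ in which the type constant $\perp$ does not occur. If $T$ is a closed $\lambda$-term with $\vdash_{\mathcal F} T : D^*\rightarrow\neg\neg D$, then $T$ is a storage operator for $D$: for every $\lambda$-term $t$ with $\vdash_{\mathcal F} t : D$ there exist $\lambda$-terms $\tau,\tau'$ with $\tau\simeq_\beta\tau'$ and $\vdash_{\mathcal F}\tau' : D$ such that for every $\lambda$-term $\theta_t\simeq_\beta t$ there is a substitution $\sigma$ with $(T)\theta_t f\succ_f (f)\sigma(\tau)$, where $f$ is a fresh variable.
   Context: $\lambda$-terms are those of the untyped $\lambda$-calculus; $\simeq_\beta$ is $\beta$-equivalence; $Fv(t)$ the free variables; normal means without $\beta$-redex. $u\succ_f v$ means $v$ is obtained from $u$ by weak head reduction (repeatedly reducing the redex $(\lambda x u)v$ in a term $(\lambda x u)v v_1\dots v_m$). Types of system $\mathcal F$ are built from type variables and type constants (atomic, not quantifiable; in particular distinct constants $O$ and $\perp$) with $\rightarrow$, $\forall$; only proper types (in every $\forall XA$, $X$ occurs free in $A$). Typing: (ax) $\Gamma \vdash x_i : A_i$ for $x_i:A_i\in\Gamma$; ($\rightarrow_i$) from $\Gamma, x:B \vdash t : C$ infer $\Gamma \vdash \lambda x t : B \rightarrow C$; ($\rightarrow_e$) from $\Gamma \vdash u : B\rightarrow C$, $\Gamma \vdash v : B$ infer $\Gamma \vdash (u)v : C$; ($\forall_i$) from $\Gamma \vdash t : A$, $X$ not free in $\Gamma$, infer $\Gamma \vdash t : \forall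 X A$; ($\forall_e$) from $\Gamma \vdash t : \forall X A$ infer $\Gamma \vdash t : A[C/X]$. $\mathcal F_0$ is $\mathcal F$ without ($\forall_e$). An input type is a closed type $E$ such that for every normal $t$, $\vdash_{\mathcal F} t:E$ implies $\vdash_{\mathcal F_0} t:E$. An output type is a closed type $S$ not containing $O$ such that for every normal $t$ and variable $\alpha$, $\alpha:O\vdash_{\mathcal F}t:S$ implies $\alpha\notin Fv(t)$. $\neg A$ denotes $A\rightarrow\perp$; $A^*$ is obtained from $A$ by replacing each atomic subformula $R$ by $\neg R$. *)

(* Defs.v *)
From Stdlib Require Import List Relations.
Import ListNotations.

Definition scons {A : Type} (x : A) (f : nat -> A) (n : nat) : A :=
  match n with 0 => x | S m => f m end.

Inductive term : Type :=
| var : nat -> term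
| app : term -> term -> term
| lam : term -> term.

Fixpoint rename (xi : nat -> nat) (t : term) : term :=
  match t with
  | var n => var (xi n)
  | app u v => app (rename xi u) (rename xi v)
  | lam u => lam (rename (scons 0 (fun n => S (xi n))) u)
  end.

Definition up (s : nat -> term) : nat -> term :=
  scons (var 0) (fun n => rename S (s n)).

Fixpoint subst (s : nat -> term) (t : term) : term :=
  match t with
  | var n => s n
  | app u v => app (subst s u) (subst s v)
  | lam u => lam (subst (up s) u)
  end.

Definition subst1 (v u : term) : term := subst (scons v var) u.

Fixpoint free (n : nat) (t : term) : Prop :=
  match t with
  | var m => m = n
  | app u v => free n u \/ free n v
  | lam u => free (S n) u
  end.

Definition closed_term (t : term) : Prop := forall n, ~ free n t.

Inductive beta : term -> term -> Prop :=
| beta_redex : forall u v, beta (app (lam u) v) (subst1 v u)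
| beta_appl : forall u u' v, beta u u' -> beta (app u v) (app u' v)
| beta_appr : forall u v v', beta v v' -> beta (app u v) (app u v')
| beta_lam : forall u u', beta u u' -> beta (lam u) (lam u').

Definition beta_eq : term -> term -> Prop := clos_refl_sym_trans term beta.

Fixpoint has_redex (t : term) : bool :=
  match t with
  | var _ => false
  | app (lam _) _ => true
  | app u v => has_redex u || has_redex v
  | lam u => has_redex u
  end.
Definition normal (t : term) : Prop := has_redex t = false.

Inductive wh_step : term -> term -> Prop :=
| wh_redex : forall u v, wh_step (app (lam u) v) (subst1 v u)
| wh_app : forall u u' w, wh_step u u' -> wh_step (app u w) (app u' w).

Definition wh_red : term -> term -> Prop := clos_refl_trans term wh_step.

Inductive ty : Type :=
| tvar : nat -> ty
| tconst : nat -> ty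
| arrow : ty -> ty -> ty
| all : ty -> ty.

Definition cO : nat := 0.
Definition cbot : nat := 1.
Definition tO : ty := tconst cO.
Definition tbot : ty := tconst cbot.

Definition neg (A : ty) : ty := arrow A tbot.

Fixpoint trename (xi : nat -> nat) (A : ty) : ty :=
  match A with
  | tvar n => tvar (xi n)
  | tconst c => tconst c
  | arrow A B => arrow (trename xi A) (trename xi B)
  | all A => all (trename (scons 0 (fun n => S (xi n))) A)
  end.

Definition tup (s : nat -> ty) : nat -> ty :=
  scons (tvar 0) (fun n => trename S (s n)).

Fixpoint tsubst (s : nat -> ty) (A : ty) : ty :=
  match A with
  | tvar n => s n
  | tconst c => tconst c
  | arrow A B => arrow (tsubst s A) (tsubst s B)
  | all A => all (tsubst (tup s) A)
  end.

Definition tsubst1 (C A : ty) : ty := tsubst (scons C tvar) A.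

Fixpoint tfree (k : nat) (A : ty) : Prop :=
  match A with
  | tvar n => n = k
  | tconst _ => False
  | arrow A B => tfree k A \/ tfree k B
  | all A => tfree (S k) A
  end.

Definition closed_ty (A : ty) : Prop := forall k, ~ tfree k A.

Fixpoint const_occ (c : nat) (A : ty) : Prop :=
  match A with
  | tvar _ => False
  | tconst d => d = c
  | arrow A B => const_occ c A \/ const_occ c B
  | all A => const_occ c A
  end.

Fixpoint proper (A : ty) : Prop :=
  match A with
  | tvar _ | tconst _ => True
  | arrow A B => proper A /\ proper B
  | all A => tfree 0 A /\ proper A
  end.

Fixpoint star (A : ty) : ty :=
  match A with
  | tvar n => neg (tvar n)
  | tconst c => neg (tconst c)
  | arrow A B => arrow (star A) (star B)
  | all A => all (star A)
  end.

(* typing.  Contexts: list of types, the i-th entry types variable i.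
   [typing true] is system F, [typing false] is F_0 (no forall-elim).
   Only proper types are formed. *)
Inductive typing (elim : bool) : list ty -> term -> ty -> Prop :=
| ty_ax : forall G n A, nth_error G n = Some A -> typing elim G (var n) A
| ty_abs : forall G B C t, proper B -> typing elim (B :: G) t C ->
    typing elim G (lam t) (arrow B C)
| ty_app : forall G u v B C, typing elim G u (arrow B C) ->
    typing elim G v B -> typing elim G (app u v) C
| ty_alli : forall G t A, tfree 0 A ->
    (* X (= index 0) not free in G: G is shifted *)
    typing elim (map (trename S) G) t A -> typing elim G t (all A)
| ty_alle : forall G t A C, elim = true -> proper C ->
    typing elim G t (all A) -> typing elim G t (tsubst1 C A).

Definition typF := typing true.
Definition typF0 := typing false.

Definition input_type (E : ty) : Prop :=
  proper E /\ closed_ty E /\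
  forall t, normal t -> typF [] t E -> typF0 [] t E.

Definition output_type (S : ty) : Prop :=
  proper S /\ closed_ty S /\ ~ const_occ cO S /\
  forall t, normal t -> typF [tO] t S -> ~ free 0 t.

Definition syntactical_data_type (D : ty) : Prop :=
  input_type D /\ output_type D.

Definition storage_operator (T : term) (D : ty) : Prop :=
  forall t, typF [] t D ->
  exists tau tau', beta_eq tau tau' /\ typF [] tau' D /\
    forall theta, beta_eq theta t ->
    forall f, ~ free f theta -> ~ free f T ->
    exists sigma : nat -> term,
      wh_red (app (app T theta) (var f)) (app (var f) (subst sigma tau)).

(* Main.v *)
(* Replace [bot] by [O] everywhere, so that [T : D' -> (D -> O) -> O] where [D'] turns the
   atoms [R] of [D] into [R -> O].  Since [D] is an input type, the normal form [t0] of [t]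
   is typable without quantifier elimination; such derivations are stable under [A |-> A'].
   Evaluate [T x f] with [x] an opaque box standing for [t0].  When a box for [lam u]
   reaches the head with an argument [c], replace it by a new box for [u] recording [c];
   when it stands for [x_j u1 ... un], replace it by the recorded value of [x_j] applied to
   new boxes for the [ui].  Subterms of [t0] keep their types, so each state has type [O];
   as [T t0 f] is strongly normalizing, evaluation stops, necessarily at [f tau] with
   [tau : D].  By standardization the same steps are performed whatever [theta] beta-equal
   to [t0] is hidden in the box, and the substitution [sigma] reveals the boxes.
   Finally, boxes and [f] can be instantiated in [tau] by functions constantly equal to
   [alpha : O].  As [D] is an output type, [alpha] disappears from the normal form, hence
   the normal form [tau'] of [tau] contains neither boxes nor [f]. *)
From Stdlib Require Import List Relations Lia Bool Arith.
Require Import Defs.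
Import ListNotations.

(** * Substitution on terms *)

Lemma subst_ext_free t : forall s s', (forall n, free n t -> s n = s' n) ->
  subst s t = subst s' t.
Proof.
  induction t as [m|u IHu v IHv|u IHu]; intros s s' H; simpl in *.
  - apply H; reflexivity.
  - f_equal; auto.
  - f_equal. apply IHu. intros [|n] Hn; simpl; [reflexivity|].
    now rewrite (H n).
Qed.

Lemma subst_ext s s' t : (forall n, s n = s' n) -> subst s t = subst s' t.
Proof. intros H; apply subst_ext_free; auto. Qed.

Lemma rename_subst_var t : forall xi, rename xi t = subst (fun n => var (xi n)) t.
Proof.
  induction t as [m|u IHu v IHv|u IHu]; intros xi; simpl; f_equal; auto.
  rewrite IHu. apply subst_ext. now intros [|n].
Qed.

Lemma subst_rename t : forall s xi, subst s (rename xi t) = subst (fun n => s (xi n)) t.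
Proof.
  induction t as [m|u IHu v IHv|u IHu]; intros s xi; simpl; f_equal; auto.
  rewrite IHu. apply subst_ext. now intros [|n].
Qed.

Lemma rename_rename t xi ze : rename xi (rename ze t) = rename (fun n => xi (ze n)) t.
Proof. now rewrite (rename_subst_var (rename ze t)), subst_rename, <- rename_subst_var. Qed.

Lemma rename_subst t : forall xi s, rename xi (subst s t) = subst (fun n => rename xi (s n)) t.
Proof.
  induction t as [m|u IHu v IHv|u IHu]; intros xi s; simpl; f_equal; auto.
  rewrite IHu. apply subst_ext. intros [|n]; simpl; [reflexivity|].
  now rewrite !rename_rename.
Qed.

Lemma subst_subst t : forall s r, subst s (subst r t) = subst (fun n => subst s (r n)) t.
Proof.
  induction t as [m|u IHu v IHv|u IHu]; intros s r; simpl; f_equal; auto.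
  rewrite IHu. apply subst_ext. intros [|n]; simpl; [reflexivity|].
  now rewrite subst_rename, rename_subst.
Qed.

Lemma subst_var t : subst var t = t.
Proof.
  induction t as [m|u IHu v IHv|u IHu]; simpl; f_equal; auto.
  rewrite <- IHu at 2. apply subst_ext. now intros [|n].
Qed.

Lemma subst1_subst_up v s u : subst1 v (subst (up s) u) = subst (scons v s) u.
Proof.
  unfold subst1. rewrite subst_subst. apply subst_ext. intros [|n]; simpl; [reflexivity|].
  rewrite subst_rename. apply subst_var.
Qed.

Lemma subst_subst1 s v u : subst s (subst1 v u) = subst1 (subst s v) (subst (up s) u).
Proof.
  rewrite subst1_subst_up. unfold subst1. rewrite subst_subst.
  apply subst_ext. now intros [|n].
Qed.

Lemma subst_closed t s : (forall n, ~ free n t) -> subst s t = t.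
Proof.
  intros H. rewrite <- (subst_var t) at 2. apply subst_ext_free.
  intros n Hn; now elim (H n).
Qed.

(** * Beta reduction *)

Definition reds : term -> term -> Prop := clos_refl_trans term beta.

Lemma reds_app u u' v v' : reds u u' -> reds v v' -> reds (app u v) (app u' v').
Proof.
  intros Hu Hv. apply rt_trans with (app u' v).
  - induction Hu; [apply rt_step; now constructor | apply rt_refl | eapply rt_trans; eauto].
  - induction Hv; [apply rt_step; now constructor | apply rt_refl | eapply rt_trans; eauto].
Qed.

Lemma reds_lam u u' : reds u u' -> reds (lam u) (lam u').
Proof.
  induction 1; [apply rt_step; now constructor | apply rt_refl | eapply rt_trans; eauto].
Qed.

Lemma beta_subst t t' : beta t t' -> forall s, beta (subst s t) (subst s t').
Proof.
  induction 1; intros s; simpl; try (constructor; auto).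
  rewrite subst_subst1. constructor.
Qed.

Lemma reds_subst s t t' : reds t t' -> reds (subst s t) (subst s t').
Proof.
  induction 1; [apply rt_step; now apply beta_subst | apply rt_refl | eapply rt_trans; eauto].
Qed.

Lemma reds_beta_eq t t' : reds t t' -> beta_eq t t'.
Proof.
  induction 1; [now apply rst_step | apply rst_refl | eapply rst_trans; eauto].
Qed.

Definition is_lam (t : term) : bool := match t with lam _ => true | _ => false end.

Lemma normal_app u v :
  normal (app u v) <-> is_lam u = false /\ normal u /\ normal v.
Proof.
  unfold normal. destruct u; simpl; rewrite ?orb_false_iff; intuition discriminate.
Qed.

Lemma not_normal_beta t : has_redex t = true -> exists t', beta t t'.
Proof.
  induction t as [m|u IHu v IHv|u IHu]; simpl; intros H.
  - discriminate.
  - destruct u as [m|u1 u2|u].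
    + destruct IHv as [v' Hv]; [exact H|]. exists (app (var m) v'). now constructor.
    + apply orb_true_iff in H as [H|H].
      * destruct IHu as [u' Hu]; [exact H|]. exists (app u' v). now constructor.
      * destruct IHv as [v' Hv]; [exact H|]. exists (app (app u1 u2) v'). now constructor.
    + eexists; constructor.
  - destruct IHu as [u' Hu]; [exact H|]. exists (lam u'). now constructor.
Qed.

(** * Church-Rosser towards a normal form *)

(** Parallel reduction of Tait and Martin-Löf: unlike [beta] it has the diamond property in one
    step, and the two have the same reflexive transitive closure. *)
Inductive par : term -> term -> Prop :=
| par_var n : par (var n) (var n)
| par_app u u' v v' : par u u' -> par v v' -> par (app u v) (app u' v')
| par_lam u u' : par u u' -> par (lam u) (lam u')
| par_redex u u' v v' : par u u' -> par v v' -> par (app (lam u) v) (subst1 v' u').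

Lemma par_refl t : par t t.
Proof. induction t; constructor; auto. Qed.

Lemma beta_par t t' : beta t t' -> par t t'.
Proof. induction 1; constructor; auto using par_refl. Qed.

Lemma par_reds t t' : par t t' -> reds t t'.
Proof.
  induction 1.
  - apply rt_refl.
  - now apply reds_app.
  - now apply reds_lam.
  - eapply rt_trans; [|apply rt_step; apply beta_redex].
    apply reds_app; [now apply reds_lam | assumption].
Qed.

Lemma par_rename t t' : par t t' -> forall xi, par (rename xi t) (rename xi t').
Proof.
  induction 1; intros xi; simpl; try (constructor; auto).
  rewrite (rename_subst_var (subst1 v' u')), subst_subst1.
  replace (subst (up (fun n => var (xi n))) u')
    with (rename (scons 0 (fun n => S (xi n))) u')
    by (rewrite rename_subst_var; apply subst_ext; now intros [|n]).
  rewrite <- rename_subst_var. constructor; auto.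
Qed.

Lemma par_up s s' : (forall n, par (s n) (s' n)) -> forall n, par (up s n) (up s' n).
Proof. intros H [|n]; simpl; [apply par_refl|]. now apply par_rename. Qed.

Lemma par_subst t t' : par t t' -> forall s s', (forall n, par (s n) (s' n)) ->
  par (subst s t) (subst s' t').
Proof.
  induction 1; intros s s' Hs; simpl; auto; try (constructor; auto using par_up).
  rewrite subst_subst1. constructor; auto using par_up.
Qed.

Lemma par_subst1 u u' v v' : par u u' -> par v v' -> par (subst1 v u) (subst1 v' u').
Proof.
  intros Hu Hv. apply par_subst; [assumption|]. intros [|n]; simpl; auto using par_refl.
Qed.

(* Takahashi's complete development. *)
Fixpoint develop (t : term) : term :=
  match t with
  | var n => var n
  | lam u => lam (develop u)
  | app (lam u) v => subst1 (develop v) (develop u)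
  | app u v => app (develop u) (develop v)
  end.

(** Triangle property: [develop t] contracts every redex of [t], so whatever a parallel step skipped
    can still be contracted. All parallel reducts of [t] therefore meet in a term that depends on
    [t] alone. *)
Lemma par_develop t t' : par t t' -> par t' (develop t).
Proof.
  induction 1 as [n|u u' v v' Hu IHu Hv IHv|u u' Hu IHu|u u' v v' Hu IHu Hv IHv].
  - constructor.
  - destruct u as [m|u1 u2|u]; simpl; try (constructor; assumption).
    inversion Hu; subst. inversion IHu; subst. now constructor.
  - now constructor.
  - now apply par_subst1.
Qed.

Lemma par_normal t t' : par t t' -> normal t -> t' = t.
Proof.
  induction 1; intros Hn; auto.
  - apply normal_app in Hn as (_ & Hu & Hv). f_equal; auto.
  - f_equal; auto.
  - discriminate.
Qed.

(** Both [y] and the second term of the sequence step to [develop x]. Pushing this diamond along the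
    sequence ends at [t], which a normal term cannot leave. *)
Lemma par_star_normal_step t x : normal t -> clos_refl_trans_1n term par x t ->
  forall y, par x y -> clos_refl_trans_1n term par y t.
Proof.
  intros Ht. induction 1 as [t|x z t Hxz _ IH]; intros y Hy.
  - apply par_normal in Hy as ->; [apply rt1n_refl | assumption].
  - apply Relation_Operators.rt1n_trans with (develop x).
    + now apply par_develop.
    + apply (IH Ht). now apply par_develop.
Qed.

(** Turns reduction to a fixed normal form into an invariant of beta-equality; this is the only form
    of confluence used. *)
Lemma reds_normal_iff t x y : normal t -> beta x y -> (reds x t <-> reds y t).
Proof.
  intros Ht Hxy. split; intros H.
  - apply clos_rt_rt1n in H.
    assert (Hp : clos_refl_trans_1n term par x t).
    { clear Hxy. induction H; [apply rt1n_refl|].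
      eapply Relation_Operators.rt1n_trans; [apply beta_par|]; eauto. }
    pose proof (par_star_normal_step t x Ht Hp y (beta_par _ _ Hxy)) as Hy.
    clear - Hy. induction Hy; [apply rt_refl|].
    eapply rt_trans; [apply par_reds|]; eauto.
  - eapply rt_trans; [apply rt_step|]; eauto.
Qed.

Lemma beta_eq_normal x t : normal t -> beta_eq x t -> reds x t.
Proof.
  intros Ht H.
  assert (Hiff : forall a b, beta_eq a b -> (reds a t <-> reds b t)).
  { induction 1; [now apply reds_normal_iff | tauto | tauto | tauto]. }
  apply (Hiff _ _ H), rt_refl.
Qed.

(** * Standardization *)

Lemma wh_step_beta t t' : wh_step t t' -> beta t t'.
Proof. induction 1; now constructor. Qed.

Lemma wh_step_subst t t' s : wh_step t t' -> wh_step (subst s t) (subst s t').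
Proof.
  induction 1; simpl; [rewrite subst_subst1|]; now constructor.
Qed.

Lemma wh_red_subst t t' s : wh_red t t' -> wh_red (subst s t) (subst s t').
Proof.
  induction 1; [apply rt_step; now apply wh_step_subst | apply rt_refl | eapply rt_trans; eauto].
Qed.

Lemma wh_red_app t t' v : wh_red t t' -> wh_red (app t v) (app t' v).
Proof.
  induction 1; [apply rt_step; now constructor | apply rt_refl | eapply rt_trans; eauto].
Qed.

(* Kashima's inductive description of the end points of standard reductions. *)
Inductive std : term -> term -> Prop :=
| std_var t n : wh_red t (var n) -> std t (var n)
| std_app t u u' v v' : wh_red t (app u v) -> std u u' -> std v v' -> std t (app u' v')
| std_lam t u u' : wh_red t (lam u) -> std u u' -> std t (lam u').

Lemma std_refl t : std t t.
Proof. induction t; econstructor; eauto; apply rt_refl. Qed.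

Lemma std_wh t t' s : wh_red t t' -> std t' s -> std t s.
Proof.
  intros H Hs; inversion Hs; subst.
  - apply std_var. eapply rt_trans; eassumption.
  - eapply std_app; [eapply rt_trans; eassumption| |]; assumption.
  - eapply std_lam; [eapply rt_trans; eassumption|assumption].
Qed.

Lemma std_rename t s : std t s -> forall xi, std (rename xi t) (rename xi s).
Proof.
  assert (W : forall t t' xi, wh_red t t' -> wh_red (rename xi t) (rename xi t')).
  { intros a b xi. rewrite !rename_subst_var. apply wh_red_subst. }
  induction 1; intros xi.
  - apply std_wh with (rename xi (var n)); [auto | apply std_refl].
  - eapply std_app; [apply (W _ _ xi H)| |]; auto.
  - eapply std_lam; [apply (W _ _ xi H)|]; auto.
Qed.

Lemma std_subst t s : std t s -> forall r r', (forall n, std (r n) (r' n)) ->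
  std (subst r t) (subst r' s).
Proof.
  induction 1 as [t n H|t u u' v v' H _ IHu _ IHv|t u u' H _ IHu]; intros r r' Hr;
    apply wh_red_subst with (s := r) in H.
  - eapply std_wh; [exact H|]. apply Hr.
  - eapply std_app; [exact H| |]; auto.
  - eapply std_lam; [exact H|]. apply IHu. intros [|n]; simpl; [apply std_refl|].
    now apply std_rename.
Qed.

Lemma std_app_inv t u v : std t (app u v) ->
  exists u' v', wh_red t (app u' v') /\ std u' u /\ std v' v.
Proof. inversion 1; subst; eauto. Qed.

Lemma std_lam_inv t u : std t (lam u) -> exists u', wh_red t (lam u') /\ std u' u.
Proof. inversion 1; subst; eauto. Qed.

(** When the added step contracts a redex, weak head reduction of the source already exposes an
    abstraction with an argument. Contracting it there is still weak head reduction, and [std_subst]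
    supplies the remainder. *)
Lemma std_beta s s' : beta s s' -> forall t, std t s -> std t s'.
Proof.
  induction 1 as [u v|u u' v _ IH|u v v' _ IH|u u' _ IH]; intros t Ht.
  - apply std_app_inv in Ht as (a & b & Hw & Ha & Hb).
    apply std_lam_inv in Ha as (p & Hp & Hs).
    eapply std_wh.
    + eapply rt_trans; [exact Hw|]. eapply rt_trans; [apply wh_red_app, Hp|].
      apply rt_step, wh_redex.
    + apply std_subst; [assumption|]. intros [|n]; simpl; [assumption|apply std_refl].
  - apply std_app_inv in Ht as (a & b & Hw & Ha & Hb). eapply std_app; eauto.
  - apply std_app_inv in Ht as (a & b & Hw & Ha & Hb). eapply std_app; eauto.
  - apply std_lam_inv in Ht as (p & Hw & Hp). eapply std_lam; eauto.
Qed.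

Lemma reds_std t s : reds t s -> std t s.
Proof.
  intros H. apply clos_rt_rtn1 in H.
  induction H; [apply std_refl | eapply std_beta; eauto].
Qed.

(** Kept generic in [P] so that [unfold_neutral] serves the official run, with equality, and the
    runs on beta-equal terms, with [std]. *)
Inductive same_spine (P : term -> term -> Prop) : term -> term -> Prop :=
| ss_var n : same_spine P (var n) (var n)
| ss_app u u' v v' : same_spine P u u' -> P v v' -> same_spine P (app u v) (app u' v').

(** Each application node of [u] is exposed by weak head reduction of a function part, and such
    reduction is allowed below arguments. The steps therefore compose down to the head variable,
    leaving only the arguments to be standardized. *)
Lemma std_neutral_inv u : normal u -> is_lam u = false -> forall t, std t u ->
  exists t', wh_red t t' /\ same_spine std t' u.
Proof.
  induction u as [m|u IHu v _|u _]; intros Hn Hl t Ht.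
  - exists (var m). inversion Ht; subst. split; [assumption|constructor].
  - apply normal_app in Hn as (Hu & Hnu & _).
    apply std_app_inv in Ht as (a & b & Hw & Ha & Hb).
    destruct (IHu Hnu Hu _ Ha) as (u' & Hw' & Hs).
    exists (app u' b). split; [|now constructor].
    eapply rt_trans; [exact Hw|]. now apply wh_red_app.
  - discriminate.
Qed.

(** * Strong normalization of system F *)

Definition SN : term -> Prop := Acc (fun t' t => beta t t').

Lemma SN_beta t t' : SN t -> beta t t' -> SN t'.
Proof. intros H Hb. exact (Acc_inv H Hb). Qed.

Lemma SN_subst_inv s t : SN (subst s t) -> SN t.
Proof.
  intros H. remember (subst s t) as r eqn:E. revert t E.
  induction H as [r _ IH]; intros t ->. constructor; intros t' Ht.
  eapply IH; [|reflexivity]. now apply beta_subst.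
Qed.

Lemma SN_app_inv u v : SN (app u v) -> SN u.
Proof.
  intros H. remember (app u v) as r eqn:E. revert u E.
  induction H as [r _ IH]; intros u ->. constructor; intros u' Hu.
  eapply IH; [|reflexivity]. now constructor.
Qed.

Lemma SN_normal_form t : SN t -> exists n, reds t n /\ normal n.
Proof.
  induction 1 as [t _ IH]. destruct (has_redex t) eqn:E.
  - destruct (not_normal_beta t E) as [t' Ht].
    destruct (IH t' Ht) as (n & Hr & Hn). exists n; split; [|assumption].
    eapply rt_trans; [apply rt_step|]; eauto.
  - exists t; split; [apply rt_refl | exact E].
Qed.

(** Girard's reducibility candidates, with his conditions CR1, CR2 and CR3. *)
Record candidate (P : term -> Prop) : Prop := {
  cand_SN : forall t, P t -> SN t;
  cand_beta : forall t t', P t -> beta t t' -> P t';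
  cand_neutral : forall t, is_lam t = false -> (forall t', beta t t' -> P t') -> P t }.

Lemma cand_var P n : candidate P -> P (var n).
Proof. intros H. apply H; [reflexivity|]. inversion 1. Qed.

Lemma SN_candidate : candidate SN.
Proof.
  split; [easy | apply SN_beta |]. intros t _ H. now constructor.
Qed.

Fixpoint interp (eta : nat -> term -> Prop) (A : ty) (t : term) : Prop :=
  match A with
  | tvar n => eta n t
  | tconst _ => SN t
  | arrow A B => forall u, interp eta A u -> interp eta B (app t u)
  | all A => forall P, candidate P -> interp (scons P eta) A t
  end.

Lemma scons_candidate P eta : candidate P -> (forall n, candidate (eta n)) ->
  forall n, candidate (scons P eta n).
Proof. intros H1 H2 [|n]; simpl; auto. Qed.

Lemma arrow_candidate P Q : candidate P -> candidate Q ->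
  candidate (fun t => forall u, P u -> Q (app t u)).
Proof.
  intros HP HQ. split.
  - intros t Ht. apply SN_app_inv with (var 0). apply HQ, Ht, cand_var, HP.
  - intros t t' Ht Hb u Hu. eapply cand_beta; [eassumption|apply Ht, Hu|now constructor].
  (* Since [t] is not an abstraction, a step of [app t u] acts inside [t] or inside [u]; the latter
     case needs induction on the strong normalization of [u]. *)
  - intros t Hl Ht u Hu. pose proof (cand_SN _ HP _ Hu) as HS.
    induction HS as [u _ IH]. apply HQ; [reflexivity|].
    intros t' Hb. inversion Hb; subst.
    + discriminate.
    + now apply Ht.
    + apply IH; [assumption|]. eapply cand_beta; eassumption.
Qed.

Lemma interp_candidate A : forall eta, (forall n, candidate (eta n)) -> candidate (interp eta A).
Proof.
  induction A as [n|c|A IHA B IHB|A IHA]; intros eta He; simpl.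
  - apply He.
  - apply SN_candidate.
  - now apply arrow_candidate; auto.
  - assert (HA : forall P, candidate P -> candidate (interp (scons P eta) A))
      by (intros P HP; apply IHA, scons_candidate; assumption).
    split.
    + intros t Ht. eapply cand_SN; [apply (HA _ SN_candidate) | apply Ht, SN_candidate].
    + intros t t' Ht Hb P HP. eapply cand_beta; [apply (HA P HP) | apply Ht, HP | exact Hb].
    + intros t Hl Ht P HP. apply (HA P HP); [exact Hl|]. intros t' Hb. now apply Ht.
Qed.

Lemma interp_ext A : forall eta eta', (forall n t, eta n t <-> eta' n t) ->
  forall t, interp eta A t <-> interp eta' A t.
Proof.
  induction A as [n|c|A IHA B IHB|A IHA]; intros eta eta' H t; simpl.
  - apply H.
  - tauto.
  - split; intros Ht u Hu; apply (IHB _ _ H), Ht, (IHA _ _ H), Hu.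
  - assert (Hs : forall P n t, scons P eta n t <-> scons P eta' n t)
      by (intros P [|n] t'; simpl; [tauto|apply H]).
    split; intros Ht P HP; apply (IHA _ _ (Hs P)), Ht, HP.
Qed.

Lemma interp_trename A : forall eta xi t,
  interp eta (trename xi A) t <-> interp (fun n => eta (xi n)) A t.
Proof.
  induction A as [n|c|A IHA B IHB|A IHA]; intros eta xi t; simpl.
  - tauto.
  - tauto.
  - split; intros Ht u Hu; apply IHB, Ht, IHA, Hu.
  - assert (Hs : forall P n t, scons P (fun n => eta (xi n)) n t <->
      scons P eta (scons 0 (fun n => S (xi n)) n) t)
      by (intros P [|n] t'; simpl; tauto).
    split; intros Ht P HP.
    + apply (interp_ext _ _ _ (Hs P)), IHA, Ht, HP.
    + apply IHA, (interp_ext _ _ _ (Hs P)), Ht, HP.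
Qed.

Lemma interp_tsubst A : forall eta s t,
  interp eta (tsubst s A) t <-> interp (fun n => interp eta (s n)) A t.
Proof.
  induction A as [n|c|A IHA B IHB|A IHA]; intros eta s t; simpl.
  - tauto.
  - tauto.
  - split; intros Ht u Hu; apply IHB, Ht, IHA, Hu.
  - assert (Hs : forall P n t, scons P (fun n => interp eta (s n)) n t <->
      interp (scons P eta) (tup s n) t)
      by (intros P [|n] t'; simpl; [tauto|rewrite interp_trename; simpl; tauto]).
    split; intros Ht P HP.
    + apply (interp_ext _ _ _ (Hs P)), IHA, Ht, HP.
    + apply IHA, (interp_ext _ _ _ (Hs P)), Ht, HP.
Qed.

(** The redex is not an abstraction, so it suffices to treat its one-step reducts, by nested
    induction on the strong normalization of [u] and of [v]. That of [u] comes from its instance at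
    a variable, which lies in [P]. *)
Lemma redex_candidate P Q u : candidate P -> candidate Q ->
  (forall v, P v -> Q (subst1 v u)) -> forall v, P v -> Q (app (lam u) v).
Proof.
  intros HP HQ Hu v Hv.
  assert (Su : SN u)
    by (eapply SN_subst_inv, (cand_SN _ HQ), (Hu (var 0)), cand_var, HP).
  revert Hu v Hv. induction Su as [u _ IHu]. intros Hu v Hv.
  pose proof (cand_SN _ HP _ Hv) as Sv. induction Sv as [v _ IHv].
  apply HQ; [reflexivity|]. intros t' Hb. inversion Hb; subst.
  - now apply Hu.
  - inversion H2; subst. apply IHu; [assumption| |assumption].
    intros w Hw. eapply cand_beta; [exact HQ|apply Hu, Hw|]. now apply beta_subst.
  - apply IHv; [assumption|]. eapply cand_beta; eassumption.
Qed.

Lemma nth_error_map_inv {X Y : Type} (f : X -> Y) l n y :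
  nth_error (map f l) n = Some y -> exists x, nth_error l n = Some x /\ y = f x.
Proof.
  rewrite nth_error_map. destruct (nth_error l n); simpl; [|discriminate].
  intros [= <-]; eauto.
Qed.

(** Adequacy of the candidate model. Quantifier elimination instantiates the quantified candidate
    with the interpretation of [C]. *)
Lemma typing_interp e G t A : typing e G t A ->
  forall eta s, (forall n, candidate (eta n)) ->
  (forall n B, nth_error G n = Some B -> interp eta B (s n)) ->
  interp eta A (subst s t).
Proof.
  induction 1 as [G n A Hn|G B C t HB Ht IH|G u v B C Hu IHu Hv IHv|G t A Hf Ht IH
    |G t A C He HC Ht IH]; intros eta s Heta Hs; simpl.
  - auto.
  - intros v Hv.
    apply (redex_candidate (interp eta B)); auto using interp_candidate.
    intros w Hw. rewrite subst1_subst_up. apply IH; [assumption|].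
    intros [|n] A; simpl; [now intros [= <-]|apply Hs].
  - apply (IHu eta s Heta Hs), (IHv eta s Heta Hs).
  - intros P HP. apply IH; [now apply scons_candidate|].
    intros n B HB. apply nth_error_map_inv in HB as (B' & HB & ->).
    apply interp_trename. apply Hs in HB. exact HB.
  - apply interp_tsubst.
    specialize (IH eta s Heta Hs). simpl in IH.
    eapply interp_ext; [|apply (IH (interp eta C)); now apply interp_candidate].
    intros [|n] t'; simpl; tauto.
Qed.

Lemma typing_SN e G t A : typing e G t A -> SN t.
Proof.
  intros H.
  assert (HS : forall n : nat, candidate ((fun _ => SN) n)) by (intros; apply SN_candidate).
  rewrite <- (subst_var t).
  apply (cand_SN _ (interp_candidate A _ HS)).
  eapply typing_interp; [eassumption|assumption|].
  intros n B _. apply cand_var. now apply interp_candidate.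
Qed.

(** * Substitution on types *)

Lemma tsubst_ext_free A : forall s s', (forall n, tfree n A -> s n = s' n) ->
  tsubst s A = tsubst s' A.
Proof.
  induction A as [n|c|A IHA B IHB|A IHA]; intros s s' H; simpl in *; auto.
  - f_equal; auto.
  - f_equal. apply IHA. intros [|n] Hn; simpl; [reflexivity|].
    now rewrite (H n).
Qed.

Lemma tsubst_ext s s' A : (forall n, s n = s' n) -> tsubst s A = tsubst s' A.
Proof. intros H; apply tsubst_ext_free; auto. Qed.

Lemma trename_tsubst_tvar A : forall xi, trename xi A = tsubst (fun n => tvar (xi n)) A.
Proof.
  induction A as [n|c|A IHA B IHB|A IHA]; intros xi; simpl; f_equal; auto.
  rewrite IHA. apply tsubst_ext. now intros [|n].
Qed.

Lemma tsubst_trename A : forall s xi, tsubst s (trename xi A) = tsubst (fun n => s (xi n)) A.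
Proof.
  induction A as [n|c|A IHA B IHB|A IHA]; intros s xi; simpl; f_equal; auto.
  rewrite IHA. apply tsubst_ext. now intros [|n].
Qed.

Lemma trename_trename A xi ze : trename xi (trename ze A) = trename (fun n => xi (ze n)) A.
Proof. now rewrite (trename_tsubst_tvar (trename ze A)), tsubst_trename, <- trename_tsubst_tvar. Qed.

Lemma trename_tsubst A : forall xi s,
  trename xi (tsubst s A) = tsubst (fun n => trename xi (s n)) A.
Proof.
  induction A as [n|c|A IHA B IHB|A IHA]; intros xi s; simpl; f_equal; auto.
  rewrite IHA. apply tsubst_ext. intros [|n]; simpl; [reflexivity|].
  now rewrite !trename_trename.
Qed.

Lemma tsubst_tsubst A : forall s r, tsubst s (tsubst r A) = tsubst (fun n => tsubst s (r n)) A.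
Proof.
  induction A as [n|c|A IHA B IHB|A IHA]; intros s r; simpl; f_equal; auto.
  rewrite IHA. apply tsubst_ext. intros [|n]; simpl; [reflexivity|].
  now rewrite tsubst_trename, trename_tsubst.
Qed.

Lemma tsubst_tvar A : tsubst tvar A = A.
Proof.
  induction A as [n|c|A IHA B IHB|A IHA]; simpl; f_equal; auto.
  rewrite <- IHA at 2. apply tsubst_ext. now intros [|n].
Qed.

Lemma tsubst_closed A s : closed_ty A -> tsubst s A = A.
Proof.
  intros H. rewrite <- (tsubst_tvar A) at 2. apply tsubst_ext_free.
  intros n Hn; now elim (H n).
Qed.

Lemma tsubst_tup_shift s A : tsubst (tup s) (trename S A) = trename S (tsubst s A).
Proof. rewrite tsubst_trename, trename_tsubst. now apply tsubst_ext. Qed.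

Lemma tsubst1_shift C A : tsubst1 C (trename S A) = A.
Proof. unfold tsubst1. rewrite tsubst_trename. apply tsubst_tvar. Qed.

Lemma tsubst_tsubst1 s C A : tsubst s (tsubst1 C A) = tsubst1 (tsubst s C) (tsubst (tup s) A).
Proof.
  unfold tsubst1. rewrite !tsubst_tsubst. apply tsubst_ext.
  intros [|n]; simpl; [reflexivity|]. symmetry. apply tsubst1_shift.
Qed.

Lemma tfree_trename A : forall xi k, tfree k A -> tfree (xi k) (trename xi A).
Proof.
  induction A as [n|c|A IHA B IHB|A IHA]; simpl; intros xi k H.
  - now subst.
  - assumption.
  - destruct H; [left|right]; auto.
  - now apply (IHA (scons 0 (fun n => S (xi n))) (S k)).
Qed.

Lemma tfree_tsubst A : forall s k j, tfree k A -> tfree j (s k) -> tfree j (tsubst s A).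
Proof.
  induction A as [n|c|A IHA B IHB|A IHA]; simpl; intros s k j H Hs.
  - now subst.
  - contradiction.
  - destruct H; [left|right]; eauto.
  - apply (IHA _ (S k)); [assumption|]. simpl. now apply tfree_trename.
Qed.

Lemma proper_trename A : forall xi, proper A -> proper (trename xi A).
Proof.
  induction A as [n|c|A IHA B IHB|A IHA]; simpl; intros xi H; auto.
  - destruct H; auto.
  - destruct H as [Hf H]. split; [|auto].
    now apply (tfree_trename A (scons 0 (fun n => S (xi n))) 0).
Qed.

Definition proper_subst (s : nat -> ty) : Prop := forall n, proper (s n).

Lemma proper_subst_tvar (f : nat -> nat) : proper_subst (fun n => tvar (f n)).
Proof. now intros n. Qed.

Lemma proper_subst_scons C s : proper C -> proper_subst s -> proper_subst (scons C s).
Proof. intros H1 H2 [|n]; [exact H1|apply H2]. Qed.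

Lemma proper_subst_tup s : proper_subst s -> proper_subst (tup s).
Proof. intros H [|n]; simpl; [exact I|]. apply proper_trename, H. Qed.

Lemma tfree_tup s A : tfree 0 A -> tfree 0 (tsubst (tup s) A).
Proof. intros H. now apply (tfree_tsubst A _ 0). Qed.

Lemma proper_tsubst A : forall s, proper_subst s -> proper A -> proper (tsubst s A).
Proof.
  induction A as [n|c|A IHA B IHB|A IHA]; simpl; intros s Hs H; auto.
  - destruct H; auto.
  - destruct H; auto using tfree_tup, proper_subst_tup.
Qed.

Lemma map_tsubst_shift s G :
  map (tsubst (tup s)) (map (trename S) G) = map (trename S) (map (tsubst s) G).
Proof. rewrite !map_map. apply map_ext, tsubst_tup_shift. Qed.

Lemma map_tsubst1_shift C G : map (tsubst1 C) (map (trename S) G) = G.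
Proof.
  rewrite map_map. rewrite <- (map_id G) at 2. apply map_ext, tsubst1_shift.
Qed.

Lemma map_trename_tsubst xi G : map (trename xi) G = map (tsubst (fun n => tvar (xi n))) G.
Proof. apply map_ext. intros A; apply trename_tsubst_tvar. Qed.

Definition closed_ctx (G : list ty) : Prop := Forall closed_ty G.

Lemma map_tsubst_closed s G : closed_ctx G -> map (tsubst s) G = G.
Proof. induction 1; simpl; f_equal; auto using tsubst_closed. Qed.

Lemma map_trename_closed xi G : closed_ctx G -> map (trename xi) G = G.
Proof. intros H. rewrite map_trename_tsubst. now apply map_tsubst_closed. Qed.

(** * The translation with [O] in place of [bot] *)

Fixpoint starO (A : ty) : ty :=
  match A with
  | tvar n => arrow (tvar n) tO
  | tconst c => arrow (tconst c) tO
  | arrow A B => arrow (starO A) (starO B)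
  | all A => all (starO A)
  end.

Lemma starO_trename A : forall xi, starO (trename xi A) = trename xi (starO A).
Proof. induction A; intros xi; simpl; f_equal; auto. Qed.

Lemma map_starO_shift G : map starO (map (trename S) G) = map (trename S) (map starO G).
Proof. rewrite !map_map. apply map_ext. intros A; apply starO_trename. Qed.

Lemma tfree_starO A : forall k, tfree k (starO A) <-> tfree k A.
Proof.
  induction A as [n|c|A IHA B IHB|A IHA]; simpl; intros k; [tauto|tauto| |apply IHA].
  now rewrite IHA, IHB.
Qed.

Lemma proper_starO A : proper A -> proper (starO A).
Proof.
  induction A as [n|c|A IHA B IHB|A IHA]; simpl; rewrite ?tfree_starO; tauto.
Qed.

Lemma typing0_proper G t A : typing false G t A -> Forall proper G -> proper A.
Proof.
  induction 1 as [G n A Hn|G B C t HB Ht IH|G u v B C Hu IHu Hv IHv|G t A Hf Ht IH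
    |G t A C He HC Ht IH]; intros HG; simpl.
  - eapply Forall_forall; [exact HG|]. eapply nth_error_In; eassumption.
  - auto.
  - now apply IHu.
  - split; [assumption|]. apply IH. apply Forall_map.
    eapply Forall_impl; [|exact HG]. intros; now apply proper_trename.
  - discriminate.
Qed.

(** [starO] commutes with renaming but not with substitution of types, since it turns [X] into
    [X -> O]. Derivations without quantifier elimination never instantiate a type, so they survive
    the translation. *)
Lemma typing0_starO e G t A : typing false G t A -> typing e (map starO G) t (starO A).
Proof.
  induction 1 as [G n A Hn|G B C t HB Ht IH|G u v B C Hu IHu Hv IHv|G t A Hf Ht IH
    |G t A C He HC Ht IH]; simpl.
  - apply ty_ax. now apply map_nth_error.
  - apply ty_abs; [now apply proper_starO | exact IH].
  - eapply ty_app; eassumption.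
  - apply ty_alli; [now apply tfree_starO | now rewrite <- map_starO_shift].
  - discriminate.
Qed.

Fixpoint map_const (g : nat -> nat) (A : ty) : ty :=
  match A with
  | tvar n => tvar n
  | tconst c => tconst (g c)
  | arrow A B => arrow (map_const g A) (map_const g B)
  | all A => all (map_const g A)
  end.

Lemma map_const_trename g A : forall xi, map_const g (trename xi A) = trename xi (map_const g A).
Proof. induction A; intros xi; simpl; f_equal; auto. Qed.

Lemma map_const_tsubst g A : forall s,
  map_const g (tsubst s A) = tsubst (fun n => map_const g (s n)) (map_const g A).
Proof.
  induction A as [n|c|A IHA B IHB|A IHA]; intros s; simpl; f_equal; auto.
  rewrite IHA. apply tsubst_ext. intros [|n]; simpl; [reflexivity|].
  apply map_const_trename.
Qed.

Lemma tfree_map_const g A : forall k, tfree k (map_const g A) <-> tfree k A.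
Proof.
  induction A as [n|c|A IHA B IHB|A IHA]; simpl; intros k; [tauto|tauto| |apply IHA].
  now rewrite IHA, IHB.
Qed.

Lemma proper_map_const g A : proper A -> proper (map_const g A).
Proof.
  induction A as [n|c|A IHA B IHB|A IHA]; simpl; rewrite ?tfree_map_const; tauto.
Qed.

(** No typing rule inspects a constant, so [g] need not be injective: below it merges [bot] with
    [O]. *)
Lemma typing_map_const g e G t A : typing e G t A ->
  typing e (map (map_const g) G) t (map_const g A).
Proof.
  induction 1 as [G n A Hn|G B C t HB Ht IH|G u v B C Hu IHu Hv IHv|G t A Hf Ht IH
    |G t A C He HC Ht IH]; simpl.
  - apply ty_ax. now apply map_nth_error.
  - apply ty_abs; [now apply proper_map_const | exact IH].
  - eapply ty_app; eassumption.
  - apply ty_alli; [now apply tfree_map_const|].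
    replace (map (trename S) (map (map_const g) G))
      with (map (map_const g) (map (trename S) G)); [exact IH|].
    rewrite !map_map. apply map_ext. intros B; apply map_const_trename.
  - unfold tsubst1. rewrite map_const_tsubst.
    rewrite (tsubst_ext _ (scons (map_const g C) tvar)) by now intros [|n].
    apply ty_alle; auto using proper_map_const.
Qed.

Definition bot_to_O (c : nat) : nat := if Nat.eqb c cbot then cO else c.

Lemma map_const_bot_to_O A : ~ const_occ cbot A -> map_const bot_to_O A = A.
Proof.
  induction A as [n|c|A IHA B IHB|A IHA]; simpl; intros H; f_equal; auto.
  unfold bot_to_O. destruct (Nat.eqb_spec c cbot); [contradiction|reflexivity].
Qed.

Lemma map_const_star A : ~ const_occ cbot A -> map_const bot_to_O (star A) = starO A.
Proof.
  induction A as [n|c|A IHA B IHB|A IHA]; intros H.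
  - reflexivity.
  - change (arrow (map_const bot_to_O (tconst c)) tO = arrow (tconst c) tO).
    now rewrite map_const_bot_to_O.
  - simpl in *. f_equal; auto.
  - simpl in *. f_equal; auto.
Qed.

(** * Typing with boxes *)

(* A box stands for an unknown term beta-equal to [box_term], in which the variables
   below [length box_ctx] have been instantiated by [box_arg].  In a judgement in
   context [G], variable [length G + i] denotes the [i]-th box of [E].  The arguments of
   boxes are never under a binder: they live in the global context [G0]. *)
Record box : Type := Box {
  box_term : term;
  box_arg : nat -> term;
  box_ctx : list ty;
  box_ty : ty }.

(** In [bt_box], each occurrence of a box chooses its own instance [s] of the free type variables of
    its type; the recorded arguments must then be typable at that same instance. *)
Inductive btyping (G0 : list ty) (E : list box) : list ty -> term -> ty -> Prop :=
| bt_var : forall G n A, nth_error G n = Some A -> btyping G0 E G (var n) A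
| bt_box : forall G i b s, nth_error E i = Some b -> proper_subst s ->
    (forall j B, nth_error (box_ctx b) j = Some B ->
       btyping G0 E G0 (box_arg b j) (tsubst s (starO B))) ->
    btyping G0 E G (var (length G + i)) (tsubst s (starO (box_ty b)))
| bt_abs : forall G B C t, proper B -> btyping G0 E (B :: G) t C ->
    btyping G0 E G (lam t) (arrow B C)
| bt_app : forall G u v B C, btyping G0 E G u (arrow B C) ->
    btyping G0 E G v B -> btyping G0 E G (app u v) C
| bt_alli : forall G t A, tfree 0 A ->
    btyping G0 E (map (trename S) G) t A -> btyping G0 E G t (all A)
| bt_alle : forall G t A C, proper C ->
    btyping G0 E G t (all A) -> btyping G0 E G t (tsubst1 C A).

Lemma typing_bt e G0 E G1 G t A : typing e G t A -> btyping G0 E (G ++ G1) t A.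
Proof.
  intros H. revert G1.
  induction H as [G n A Hn|G B C t HB Ht IH|G u v B C Hu IHu Hv IHv|G t A Hf Ht IH
    |G t A C He HC Ht IH]; intros G1.
  - apply bt_var. rewrite nth_error_app1; [assumption|].
    apply nth_error_Some. now rewrite Hn.
  - apply bt_abs; [assumption|apply IH].
  - eapply bt_app; [apply IHu|apply IHv].
  - apply bt_alli; [assumption|]. rewrite map_app. apply IH.
  - apply bt_alle; [assumption|apply IH].
Qed.

Lemma bt_typing G0 G t A : btyping G0 [] G t A -> typing true G t A.
Proof.
  induction 1 as [G n A Hn|G i b s Hi|G B C t HB Ht IH|G u v B C Hu IHu Hv IHv|G t A Hf Ht IH
    |G t A C HC Ht IH].
  - now apply ty_ax.
  - destruct i; discriminate.
  - now apply ty_abs.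
  - eapply ty_app; eassumption.
  - now apply ty_alli.
  - now apply ty_alle.
Qed.

Lemma bt_env_app G0 E E' G t A : btyping G0 E G t A -> btyping G0 (E ++ E') G t A.
Proof.
  induction 1 as [G n A Hn|G i b s Hi Hs Ha IHa|G B C t HB Ht IH|G u v B C Hu IHu Hv IHv
    |G t A Hf Ht IH|G t A C HC Ht IH].
  - now apply bt_var.
  - apply bt_box; [|assumption|assumption]. rewrite nth_error_app1; [assumption|].
    apply nth_error_Some. now rewrite Hi.
  - now apply bt_abs.
  - eapply bt_app; eassumption.
  - now apply bt_alli.
  - now apply bt_alle.
Qed.

(** At a box the substitution composes with the instance already chosen. Closedness of [G0] keeps
    the context of the recorded arguments fixed meanwhile. *)
Lemma bt_tsubst G0 E G t A : closed_ctx G0 -> btyping G0 E G t A ->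
  forall s, proper_subst s -> btyping G0 E (map (tsubst s) G) t (tsubst s A).
Proof.
  intros H0.
  induction 1 as [G n A Hn|G i b r Hi Hr Ha IHa|G B C t HB Ht IH|G u v B C Hu IHu Hv IHv
    |G t A Hf Ht IH|G t A C HC Ht IH]; intros s Hs; simpl.
  - apply bt_var. now apply map_nth_error.
  - rewrite tsubst_tsubst, <- (length_map (tsubst s) G).
    apply bt_box; [assumption| |].
    + intros n. now apply proper_tsubst.
    + intros j B HB. specialize (IHa j B HB s Hs).
      now rewrite map_tsubst_closed, tsubst_tsubst in IHa.
  - apply bt_abs; [now apply proper_tsubst|]. now apply IH.
  - eapply bt_app; [now apply IHu|now apply IHv].
  - apply bt_alli; [now apply tfree_tup|]. rewrite <- map_tsubst_shift.
    now apply IH, proper_subst_tup.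
  - rewrite tsubst_tsubst1. apply bt_alle; [now apply proper_tsubst|]. now apply IH.
Qed.

Lemma bt_shift G0 E G t A : closed_ctx G0 -> btyping G0 E G t A ->
  btyping G0 E (map (trename S) G) t (trename S A).
Proof.
  intros H0 H. rewrite map_trename_tsubst, trename_tsubst_tvar.
  apply bt_tsubst; auto using proper_subst_tvar.
Qed.

(** Boxes are numbered from the end of the context, so the second condition says that every box
    keeps its identity when the context changes length. *)
Lemma bt_rename G0 E G t A : btyping G0 E G t A -> forall G' xi,
  (forall n B, nth_error G n = Some B -> nth_error G' (xi n) = Some B) ->
  (forall i, xi (length G + i) = length G' + i) ->
  btyping G0 E G' (rename xi t) A.
Proof.
  induction 1 as [G n A Hn|G i b r Hi Hr Ha IHa|G B C t HB Ht IH|G u v B C Hu IHu Hv IHv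
    |G t A Hf Ht IH|G t A C HC Ht IH]; intros G' xi H1 H2; simpl.
  - apply bt_var. now apply H1.
  - rewrite H2. now apply bt_box.
  - apply bt_abs; [assumption|]. apply IH.
    + intros [|n]; simpl; [trivial|apply H1].
    + intros i; simpl. now rewrite H2.
  - eapply bt_app; [now apply IHu|now apply IHv].
  - apply bt_alli; [assumption|]. apply IH.
    + intros n B HB. apply nth_error_map_inv in HB as (B' & HB & ->).
      apply map_nth_error. now apply H1.
    + intros i. rewrite !length_map. apply H2.
  - apply bt_alle; [assumption|]. now apply IH.
Qed.

Lemma bt_subst G0 E G t A : closed_ctx G0 -> btyping G0 E G t A -> forall G' s,
  (forall n B, nth_error G n = Some B -> btyping G0 E G' (s n) B) ->
  (forall i, s (length G + i) = var (length G' + i)) ->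
  btyping G0 E G' (subst s t) A.
Proof.
  intros H0.
  induction 1 as [G n A Hn|G i b r Hi Hr Ha IHa|G B C t HB Ht IH|G u v B C Hu IHu Hv IHv
    |G t A Hf Ht IH|G t A C HC Ht IH]; intros G' s H1 H2; simpl.
  - now apply H1.
  - rewrite H2. now apply bt_box.
  - apply bt_abs; [assumption|]. apply IH.
    + intros [|n] A; simpl; [intros [= <-]; now apply bt_var|]. intros HA.
      eapply bt_rename; [now apply H1| |reflexivity]. trivial.
    + intros i; simpl. now rewrite H2.
  - eapply bt_app; [now apply IHu|now apply IHv].
  - apply bt_alli; [assumption|]. apply IH.
    + intros n B HB. apply nth_error_map_inv in HB as (B' & HB & ->).
      apply bt_shift; auto.
    + intros i. rewrite !length_map. apply H2.
  - apply bt_alle; [assumption|]. now apply IH.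
Qed.

Lemma bt_subst1 G0 E G u v B C : closed_ctx G0 -> btyping G0 E (B :: G) u C ->
  btyping G0 E G v B -> btyping G0 E G (subst1 v u) C.
Proof.
  intros H0 Hu Hv. apply (bt_subst _ _ _ _ _ H0 Hu).
  - intros [|n] A; simpl; [now intros [= <-]|]. now apply bt_var.
  - reflexivity.
Qed.

Lemma bt_free G0 E G t A : btyping G0 E G t A ->
  forall n, free n t -> n < length G + length E.
Proof.
  induction 1 as [G n A Hn|G i b r Hi Hr Ha IHa|G B C t HB Ht IH|G u v B C Hu IHu Hv IHv
    |G t A Hf Ht IH|G t A C HC Ht IH]; simpl; intros m Hm.
  - subst m. assert (n < length G) by (apply nth_error_Some; now rewrite Hn). lia.
  - subst m. assert (i < length E) by (apply nth_error_Some; now rewrite Hi). lia.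
  - apply IH in Hm. simpl in Hm. lia.
  - destruct Hm; auto.
  - apply IH in Hm. now rewrite length_map in Hm.
  - auto.
Qed.

(* Structural recursion on the type makes the inversion of the rule for abstractions
   stable under both quantifier rules, with no need to permute them. *)
Fixpoint lam_inv (G0 : list ty) (E : list box) (G : list ty) (u : term) (A : ty) : Prop :=
  match A with
  | arrow B C => btyping G0 E (B :: G) u C
  | all A => lam_inv G0 E (map (trename S) G) u A
  | _ => False
  end.

Lemma lam_inv_tsubst G0 E u A : closed_ctx G0 -> forall G s, proper_subst s ->
  lam_inv G0 E G u A -> lam_inv G0 E (map (tsubst s) G) u (tsubst s A).
Proof.
  intros H0. induction A as [n|c|A _ B _|A IHA]; simpl; intros G s Hs H; try contradiction.
  - exact (bt_tsubst _ _ _ _ _ H0 H s Hs).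
  - rewrite <- map_tsubst_shift. auto using proper_subst_tup.
Qed.

Lemma bt_lam_inv G0 E G u A : closed_ctx G0 -> btyping G0 E G (lam u) A -> lam_inv G0 E G u A.
Proof.
  intros H0 H. remember (lam u) as t eqn:Et.
  induction H as [G n A Hn|G i b r Hi Hr Ha IHa|G B C t HB Ht IH|G t v B C Hu IHu Hv IHv
    |G t A Hf Ht IH|G t A C HC Ht IH]; try discriminate; simpl.
  - now injection Et as ->.
  - auto.
  - specialize (IH Et). simpl in IH.
    (* Instantiating index 0 by [C] undoes the shift of [G] made by [lam_inv] at the quantifier. *)
    rewrite <- (map_tsubst1_shift C G). apply lam_inv_tsubst; auto.
    apply proper_subst_scons; [assumption|]. now intros n.
Qed.

Lemma bt_beta G0 E G t A : closed_ctx G0 -> btyping G0 E G t A ->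
  forall t', beta t t' -> btyping G0 E G t' A.
Proof.
  intros H0.
  induction 1 as [G n A Hn|G i b r Hi Hr Ha IHa|G B C t HB Ht IH|G u v B C Hu IHu Hv IHv
    |G t A Hf Ht IH|G t A C HC Ht IH]; intros t' Hb.
  - inversion Hb.
  - inversion Hb.
  - inversion Hb; subst. apply bt_abs; auto.
  - inversion Hb; subst.
    + apply bt_lam_inv in Hu; [|assumption]. eapply bt_subst1; eassumption.
    + eapply bt_app; eauto.
    + eapply bt_app; eauto.
  - apply bt_alli; auto.
  - apply bt_alle; auto.
Qed.

Lemma bt_reds G0 E G t t' A : closed_ctx G0 -> reds t t' ->
  btyping G0 E G t A -> btyping G0 E G t' A.
Proof. intros H0. induction 1; eauto using bt_beta. Qed.

Lemma typF_reds G t t' A : reds t t' -> typF G t A -> typF G t' A.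
Proof.
  intros Hr H. apply bt_typing with (G0 := []).
  eapply bt_reds; [constructor|exact Hr|].
  rewrite <- (app_nil_r G). eapply typing_bt, H.
Qed.

Lemma typing_ext_free e G t A : typing e G t A -> forall G',
  (forall n B, free n t -> nth_error G n = Some B -> nth_error G' n = Some B) ->
  typing e G' t A.
Proof.
  induction 1 as [G n A Hn|G B C t HB Ht IH|G u v B C Hu IHu Hv IHv|G t A Hf Ht IH
    |G t A C He HC Ht IH]; intros G' H; simpl in *.
  - apply ty_ax; auto.
  - apply ty_abs; [assumption|]. apply IH. intros [|n] A; simpl; auto.
  - eapply ty_app; eauto.
  - apply ty_alli; [assumption|]. apply IH. intros n B Hn HB.
    apply nth_error_map_inv in HB as (B' & HB & ->). apply map_nth_error; auto.
  - apply ty_alle; auto.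
Qed.

(** * Closing boxes with constant functions *)

Fixpoint const_lam (k p : nat) : term :=
  match k with 0 => var p | S k => lam (const_lam k (S p)) end.

Lemma subst_const_lam k : forall s p q, s p = var q ->
  subst s (const_lam k p) = const_lam k q.
Proof.
  induction k as [|k IH]; intros s p q H; simpl; [assumption|].
  f_equal. apply IH. simpl. now rewrite H.
Qed.

Lemma rename_const_lam k xi p : rename xi (const_lam k p) = const_lam k (xi p).
Proof. rewrite rename_subst_var. now apply subst_const_lam. Qed.

Lemma free_const_lam k : forall p, free p (const_lam k p).
Proof. induction k; simpl; auto. Qed.

Lemma normal_const_lam k : forall p, normal (const_lam k p).
Proof. induction k; intros p; [reflexivity|apply IHk]. Qed.

(** Counts the arguments after which a term of type [starO A] returns [O]; an atom counts 1 because
    [starO] adds an arrow to it. *)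
Fixpoint star_arity (A : ty) : nat :=
  match A with
  | tvar _ | tconst _ => 1
  | arrow _ B => S (star_arity B)
  | all A => star_arity A
  end.

(** Every instance of [starO A] ends in [O], the type of [p], once its arguments are consumed. Hence
    one constant function fits all instances at which a box is used. *)
Lemma bt_const_lam G0 E A : proper A -> forall G p s, nth_error G p = Some tO ->
  proper_subst s -> btyping G0 E G (const_lam (star_arity A) p) (tsubst s (starO A)).
Proof.
  induction A as [n|c|A _ B IHB|A IHA]; simpl; intros HA G p s Hp Hs.
  - apply bt_abs; [apply Hs|]. now apply bt_var.
  - apply bt_abs; [exact I|]. now apply bt_var.
  - destruct HA as [HA HB]. apply bt_abs; [apply proper_tsubst; auto using proper_starO|].
    now apply IHB.
  - destruct HA as [Hf HA]. apply bt_alli; [now apply tfree_tup, tfree_starO|].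
    apply IHA; auto using proper_subst_tup.
    now apply (map_nth_error (trename S)) in Hp.
Qed.

(** Turns a judgement with boxes into an ordinary typing under a hypothesis of type [O], to which
    the definition of output types applies. *)
Lemma bt_close G0 E G t A :
  (forall i b, nth_error E i = Some b -> proper (box_ty b)) ->
  btyping G0 E G t A -> forall G' s p, nth_error G' p = Some tO ->
  (forall n B, nth_error G n = Some B -> btyping [] [] G' (s n) B) ->
  (forall i b, nth_error E i = Some b ->
     s (length G + i) = const_lam (star_arity (box_ty b)) p) ->
  btyping [] [] G' (subst s t) A.
Proof.
  intros HE.
  induction 1 as [G n A Hn|G i b r Hi Hr Ha IHa|G B C t HB Ht IH|G u v B C Hu IHu Hv IHv
    |G t A Hf Ht IH|G t A C HC Ht IH]; intros G' s p Hp H1 H2; simpl.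
  - now apply H1.
  - rewrite (H2 i b Hi). apply bt_const_lam; eauto.
  - apply bt_abs; [assumption|]. apply (IH _ _ (S p)); [assumption| |].
    + intros [|n] A; simpl; [intros [= <-]; now apply bt_var|]. intros HA.
      eapply bt_rename; [now apply H1| |reflexivity]. trivial.
    + intros i b Hi; simpl. rewrite (H2 i b Hi). apply rename_const_lam.
  - eapply bt_app; [eapply IHu|eapply IHv]; eassumption.
  - apply bt_alli; [assumption|]. apply (IH _ _ p).
    + now apply (map_nth_error (trename S)) in Hp.
    + intros n B HB. apply nth_error_map_inv in HB as (B' & HB & ->).
      apply bt_shift; [constructor|]; auto.
    + intros i b Hi. rewrite length_map. now apply H2.
  - apply bt_alle; [assumption|]. eapply IH; eassumption.
Qed.

(* The constant functions can only erase their own arguments: an outermost occurrence of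
   [p] always survives. *)
Lemma normal_subst_const_lam n : forall s p, normal n ->
  (forall m, (exists q, s m = var q) \/ (exists k, s m = const_lam k p)) ->
  exists n', normal n' /\ reds (subst s n) n' /\
    (is_lam n = false -> is_lam n' = false \/ exists k, n' = const_lam k p) /\
    (forall m k, free m n -> s m = const_lam k p -> free p n').
Proof.
  induction n as [m|u IHu v IHv|u IHu]; intros s p Hn Hs; simpl.
  - exists (s m). repeat split.
    + destruct (Hs m) as [[q ->]|[k ->]]; [reflexivity|apply normal_const_lam].
    + apply rt_refl.
    + intros _. destruct (Hs m) as [[q ->]|[k ->]]; [now left|right; eauto].
    + intros m' k <- ->. apply free_const_lam.
  - apply normal_app in Hn as (Hl & Hu & Hv).
    destruct (IHu s p Hu Hs) as (u' & Nu & Ru & Lu & Fu).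
    destruct (IHv s p Hv Hs) as (v' & Nv & Rv & _ & Fv).
    assert (Happ : is_lam u' = false -> exists n', normal n' /\
      reds (app (subst s u) (subst s v)) n' /\
      (false = false -> is_lam n' = false \/ exists k, n' = const_lam k p) /\
      (forall m k, free m u \/ free m v -> s m = const_lam k p -> free p n')).
    { intros Hu'. exists (app u' v'). repeat split.
      - now apply normal_app.
      - now apply reds_app.
      - now left.
      - intros m k [Hm|Hm] E; [left|right]; eauto. }
    (* [const_lam 0 p] is a variable and creates no redex. With arity [S k] there is one redex,
       whose contraction discards [v'] and leaves [const_lam k p]. *)
    destruct (Lu Hl) as [Hu'|[[|k] ->]]; [now apply Happ|now apply Happ|].
    exists (const_lam k p). repeat split.
    + apply normal_const_lam.
    + eapply rt_trans; [apply reds_app; eassumption|]. apply rt_step. simpl.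
      replace (const_lam k p) with (subst1 v' (const_lam k (S p)))
        by now apply subst_const_lam.
      constructor.
    + intros _. right; eauto.
    + intros; apply free_const_lam.
  - destruct (IHu (up s) (S p) Hn) as (u' & Nu & Ru & _ & Fu).
    { intros [|m]; simpl; [left; eauto|].
      destruct (Hs m) as [[q ->]|[k ->]]; [left; simpl; eauto|].
      right; exists k. apply rename_const_lam. }
    exists (lam u'). repeat split.
    + exact Nu.
    + now apply reds_lam.
    + discriminate.
    + intros m k Hm E. simpl. apply (Fu (S m) k Hm). simpl. rewrite E. apply rename_const_lam.
Qed.

(** * Head spines *)

(** Measure for the unfolding of neutral boxes, compared only through upper bounds; 0 is a default
    value on abstractions. *)
Fixpoint head_index (t : term) : nat :=
  match t with
  | var n => n
  | app u _ => head_index u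
  | lam _ => 0
  end.

Lemma head_index_free t : head_index t = 0 \/ free (head_index t) t.
Proof. induction t; simpl; tauto. Qed.

Lemma spine_decomposition t : exists h bs, t = fold_left app bs h /\
  ((exists n, h = var n) \/ exists u, h = lam u).
Proof.
  induction t as [n|u (h & bs & -> & H) v _|u _].
  - exists (var n), []. eauto.
  - exists h, (bs ++ [v]). rewrite fold_left_app. auto.
  - exists (lam u), []. eauto.
Qed.

Lemma head_index_spine bs : forall h, head_index (fold_left app bs h) = head_index h.
Proof. induction bs as [|b bs IH]; intros h; simpl; [|rewrite IH]; reflexivity. Qed.

Lemma free_spine n bs : forall h, free n h \/ (exists b, In b bs /\ free n b) ->
  free n (fold_left app bs h).
Proof.
  induction bs as [|b bs IH]; simpl; intros h [H|(c & Hc & H)].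
  - assumption.
  - contradiction.
  - apply IH. simpl; auto.
  - apply IH. destruct Hc as [->|Hc]; simpl; eauto.
Qed.

Lemma subst_spine s bs : forall h,
  subst s (fold_left app bs h) = fold_left app (map (subst s) bs) (subst s h).
Proof. induction bs as [|b bs IH]; intros h; simpl; [|rewrite IH]; reflexivity. Qed.

Lemma wh_step_spine bs : forall h h', wh_step h h' ->
  wh_step (fold_left app bs h) (fold_left app bs h').
Proof. induction bs; intros h h' H; simpl; auto using wh_app. Qed.

Lemma wh_red_spine h h' bs : wh_red h h' ->
  wh_red (fold_left app bs h) (fold_left app bs h').
Proof.
  induction 1; [apply rt_step; now apply wh_step_spine | apply rt_refl | eapply rt_trans; eauto].
Qed.

(** Quantifier rules may follow the application rule. As [G0] is closed they leave the context
    unchanged, so they can be replayed after the head has been replaced. *)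
Lemma bt_app_head G0 E E' h h' : closed_ctx G0 ->
  (forall A, btyping G0 E G0 h A -> btyping G0 (E ++ E') G0 h' A) ->
  forall b A, btyping G0 E G0 (app h b) A -> btyping G0 (E ++ E') G0 (app h' b) A.
Proof.
  intros H0 Hh b A H. remember G0 as G eqn:EG in H at 2. remember (app h b) as t eqn:Et.
  induction H as [G n A Hn|G i b' r Hi Hr Ha IHa|G B C t HB Ht IH|G u v B C Hu IHu Hv IHv
    |G t A Hf Ht IH|G t A C HC Ht IH]; try discriminate; subst G.
  - injection Et as -> ->. apply bt_app with B; [apply Hh, Hu|apply bt_env_app, Hv].
  - rewrite map_trename_closed in IH by assumption.
    apply bt_alli; [assumption|]. rewrite map_trename_closed by assumption. auto.
  - apply bt_alle; auto.
Qed.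

Lemma bt_spine_head G0 E E' bs : closed_ctx G0 -> forall h h',
  (forall A, btyping G0 E G0 h A -> btyping G0 (E ++ E') G0 h' A) ->
  forall A, btyping G0 E G0 (fold_left app bs h) A ->
            btyping G0 (E ++ E') G0 (fold_left app bs h') A.
Proof.
  intros H0. induction bs as [|b bs IH]; intros h h' Hh A; simpl; [apply Hh|].
  apply IH. intros B. now apply bt_app_head.
Qed.

Lemma bt_app_inv G0 E u v A : closed_ctx G0 -> btyping G0 E G0 (app u v) A ->
  exists B C, btyping G0 E G0 u (arrow B C) /\ btyping G0 E G0 v B.
Proof.
  intros H0 H. remember G0 as G eqn:EG in H at 2. remember (app u v) as t eqn:Et.
  induction H as [G n A Hn|G i b' r Hi Hr Ha IHa|G B C t HB Ht IH|G u' v' B C Hu IHu Hv IHv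
    |G t A Hf Ht IH|G t A C HC Ht IH]; try discriminate; subst G.
  - injection Et as -> ->. eauto.
  - rewrite map_trename_closed in IH by assumption. auto.
  - auto.
Qed.

Lemma bt_spine_inv G0 E bs : closed_ctx G0 -> forall h A,
  btyping G0 E G0 (fold_left app bs h) A -> exists B, btyping G0 E G0 h B.
Proof.
  intros H0. induction bs as [|b bs IH]; intros h A H; simpl in *; [eauto|].
  apply IH in H as [B H]. apply bt_app_inv in H as (C & C' & H & _); eauto.
Qed.

(** * Unfolding boxes *)

(* Arguments of box number [i] only mention the variable [0] and boxes created earlier. *)
Definition wf_box (i : nat) (b : box) : Prop :=
  normal (box_term b) /\
  typing false (box_ctx b) (box_term b) (box_ty b) /\
  Forall proper (box_ctx b) /\
  forall j n, j < length (box_ctx b) -> free n (box_arg b j) -> n <= i.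

Definition wf_env (E : list box) : Prop :=
  forall i b, nth_error E i = Some b -> wf_box i b.

(* [P u' u] says how the term [u'] hidden in a box may differ from its official value [u]:
   equality for the strongly normalizing run that bounds the evaluation, [std] for the runs
   on arbitrary beta-equal terms. *)
Definition real_box (P : term -> term -> Prop) (rho : nat -> term) (b : box) (v : term) : Prop :=
  exists s u', v = subst s u' /\ P u' (box_term b) /\
    forall j, j < length (box_ctx b) -> s j = subst rho (box_arg b j).

Definition realizes (P : term -> term -> Prop) (E : list box) (rho : nat -> term) : Prop :=
  forall i b, nth_error E i = Some b -> real_box P rho b (rho (S i)).

Lemma nth_error_snoc_inv {X : Type} (l : list X) x i y : nth_error (l ++ [x]) i = Some y ->
  nth_error l i = Some y \/ (i = length l /\ y = x).
Proof.
  intros H. destruct (Nat.lt_ge_cases i (length l)) as [Hi|Hi].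
  - left. now rewrite nth_error_app1 in H.
  - right. rewrite nth_error_app2 in H by assumption.
    destruct (i - length l) as [|k] eqn:Ek; simpl in H.
    + injection H as ->. split; [lia|reflexivity].
    + destruct k; discriminate.
Qed.

Lemma nth_error_snoc {X : Type} (l : list X) x : nth_error (l ++ [x]) (length l) = Some x.
Proof. now rewrite nth_error_app2, Nat.sub_diag by lia. Qed.

Lemma wf_env_snoc E b : wf_env E -> wf_box (length E) b -> wf_env (E ++ [b]).
Proof. intros HE Hb i c Hc. apply nth_error_snoc_inv in Hc as [Hc|[-> ->]]; auto. Qed.

Lemma wf_env_proper E : wf_env E -> forall i b, nth_error E i = Some b -> proper (box_ty b).
Proof. intros HE i b Hb. destruct (HE i b Hb) as (_ & Ht & HG & _). eapply typing0_proper; eauto. Qed.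

Lemma real_box_ext P rho rho' b v :
  (forall j n, j < length (box_ctx b) -> free n (box_arg b j) -> rho' n = rho n) ->
  real_box P rho b v -> real_box P rho' b v.
Proof.
  intros H (s & u' & Hv & HP & Hs). exists s, u'. repeat split; auto.
  intros j Hj. rewrite Hs by assumption. apply subst_ext_free.
  intros n Hn. symmetry; eauto.
Qed.

Lemma realizes_snoc P E rho b v : wf_env E -> wf_box (length E) b ->
  realizes P E rho -> real_box P rho b v ->
  exists rho', (forall n, n <= length E -> rho' n = rho n) /\
    rho' (S (length E)) = v /\ realizes P (E ++ [b]) rho'.
Proof.
  intros HE Hb HR Hv.
  exists (fun n => if n =? S (length E) then v else rho n).
  assert (Hold : forall n, n <= length E -> (if n =? S (length E) then v else rho n) = rho n).
  { intros n Hn. destruct (Nat.eqb_spec n (S (length E))); [lia|reflexivity]. }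
  split; [exact Hold|]. split; [now rewrite Nat.eqb_refl|].
  intros i c Hc. apply nth_error_snoc_inv in Hc as [Hc|[-> ->]].
  - assert (i < length E) by (apply nth_error_Some; now rewrite Hc).
    rewrite Hold by lia. apply real_box_ext with rho; [|now apply HR].
    intros j n Hj Hn. apply Hold. destruct (HE i c Hc) as (_ & _ & _ & H4).
    specialize (H4 j n Hj Hn). lia.
  - rewrite Nat.eqb_refl. apply real_box_ext with rho; [|assumption].
    intros j n Hj Hn. apply Hold. destruct Hb as (_ & _ & _ & H4). eauto.
Qed.

Definition args_typed (G0 : list ty) (E : list box) (a : nat -> term) (G : list ty)
    (s : nat -> ty) : Prop :=
  forall j B, nth_error G j = Some B -> btyping G0 E G0 (a j) (tsubst s (starO B)).

Lemma args_typed_shift G0 E a G s : closed_ctx G0 -> args_typed G0 E a G s ->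
  args_typed G0 E a (map (trename S) G) (tup s).
Proof.
  intros H0 H j B HB. apply nth_error_map_inv in HB as (B' & HB & ->).
  rewrite starO_trename, tsubst_tup_shift.
  rewrite <- (map_trename_closed S G0) at 2 by assumption.
  apply bt_shift; auto.
Qed.

Lemma Forall_proper_shift G : Forall proper G -> Forall proper (map (trename S) G).
Proof. intros H. apply Forall_map. eapply Forall_impl; [|exact H]. intros; now apply proper_trename. Qed.

(* The box of [x u1 ... un] unfolds to the argument substituted for [x], applied to new
   boxes for [u1], ..., [un].  Without quantifier elimination the types of the [ui] can be
   read off that of [x], whatever the instance at which the box is used. *)
Lemma unfold_neutral G0 G u A : closed_ctx G0 -> length G0 = 1 -> typing false G u A ->
  normal u -> is_lam u = false -> Forall proper G -> forall E a, wf_env E ->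
  (forall j n, j < length G -> free n (a j) -> n <= length E) ->
  exists N w, wf_env (E ++ N) /\
    (forall s, proper_subst s -> args_typed G0 E a G s ->
       btyping G0 (E ++ N) G0 w (tsubst s (starO A))) /\
    (exists j, j < length G /\ head_index w = head_index (a j)) /\
    (forall n, free n w -> n <= length (E ++ N)) /\
    (forall P rho s u', realizes P E rho -> same_spine P u' u ->
       (forall j, j < length G -> s j = subst rho (a j)) ->
       exists rho', (forall n, n <= length E -> rho' n = rho n) /\
         realizes P (E ++ N) rho' /\ subst rho' w = subst s u').
Proof.
  intros H0 HL.
  induction 1 as [G n A Hn|G B C t HB Ht IH|G u v B C Hu IHu Hv IHv|G t A Hf Ht IH
    |G t A C He HC Ht IH]; intros Nt Lt HG E a HE Ha.
  - assert (Hj : n < length G) by (apply nth_error_Some; now rewrite Hn).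
    exists [], (a n). rewrite app_nil_r.
    split; [assumption|]. split; [auto|]. split; [eauto|]. split; [eauto|].
    intros P rho s u' HR Hu Hs. inversion Hu; subst.
    exists rho. repeat split; auto. simpl. symmetry; auto.
  - discriminate.
  - apply normal_app in Nt as (Lu & Nu & Nv).
    destruct (IHu Nu Lu HG E a HE Ha) as (N & w & HEN & Tw & Hw & Fw & Rw).
    (* The argument [v] lives under the same bindings as the whole neutral term, so its box records
       the same [a]. *)
    set (b := Box v a G B).
    assert (Hb : wf_box (length (E ++ N)) b).
    { repeat split; simpl; auto. intros j n Hj Hn.
      specialize (Ha j n Hj Hn). rewrite length_app. lia. }
    exists (N ++ [b]), (app w (var (S (length (E ++ N))))). rewrite app_assoc.
    split; [|split; [|split; [|split]]].
    + now apply wf_env_snoc.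
    + intros s Hs Has. eapply bt_app.
      * apply bt_env_app. exact (Tw s Hs Has).
      (* Variable 0 is the continuation, the only entry of [G0]; box number [k] is thus variable
         [S k]. *)
      * replace (S (length (E ++ N))) with (length G0 + length (E ++ N)) by lia.
        apply (bt_box G0 _ G0 _ b s); [apply nth_error_snoc|assumption|].
        intros j F HF. rewrite <- app_assoc. apply bt_env_app. now apply Has.
    + exact Hw.
    + intros n [Hn|Hn]; rewrite length_app; simpl.
      * apply Fw in Hn. lia.
      * simpl in Hn. lia.
    + intros P rho s t HR Hsp Hs. inversion Hsp as [|u1 u2 v1 v2 Hu1 Hv1]; subst.
      destruct (Rw P rho s u1 HR Hu1 Hs) as (rho1 & Hag1 & HR1 & Ew).
      destruct (realizes_snoc P (E ++ N) rho1 b (subst s v1) HEN Hb HR1)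
        as (rho2 & Hag2 & Ev & HR2).
      { exists s, v1. repeat split; auto. simpl. intros j Hj. rewrite Hs by assumption.
        apply subst_ext_free. intros n Hn. symmetry. apply Hag1. eauto. }
      exists rho2. repeat split.
      * intros n Hn. rewrite Hag2; [now apply Hag1|]. rewrite length_app. lia.
      * exact HR2.
      * simpl. rewrite Ev, <- Ew. f_equal. apply subst_ext_free. auto.
  - rewrite <- (length_map (trename S) G) in Ha.
    destruct (IH Nt Lt (Forall_proper_shift _ HG) E a HE Ha) as (N & w & HEN & Tw & Hw & Fw & Rw).
    rewrite length_map in Hw, Rw. exists N, w.
    split; [assumption|]. split; [|auto].
    intros s Hs Has. simpl. apply bt_alli; [now apply tfree_tup, tfree_starO|].
    rewrite map_trename_closed by assumption.
    apply Tw; auto using proper_subst_tup, args_typed_shift.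
  - discriminate.
Qed.

(** Like [lam_inv], recursion on the type makes this inversion stable under both quantifier rules,
    provided [Q] is stable under instantiation. *)
Fixpoint arrow_inv (Q : ty -> ty -> Prop) (A : ty) : Prop :=
  match A with
  | arrow B C => Q B C
  | all A => arrow_inv Q A
  | _ => False
  end.

Lemma arrow_inv_tsubst Q A :
  (forall s B C, proper_subst s -> Q B C -> Q (tsubst s B) (tsubst s C)) ->
  forall s, proper_subst s -> arrow_inv Q A -> arrow_inv Q (tsubst s A).
Proof.
  intros HQ. induction A; simpl; intros s Hs H; try contradiction; auto using proper_subst_tup.
Qed.

(** The instance [s] is existential because quantifier eliminations above the box compose with it.
    The recorded arguments are typed at the same [s], as the box of the body will require. *)
Definition instance_arrow G0 E a G B C (X Y : ty) : Prop :=
  exists s, proper_subst s /\ X = tsubst s (starO B) /\ Y = tsubst s (starO C) /\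
    args_typed G0 E a G s.

Lemma instance_arrow_tsubst G0 E a G B C : closed_ctx G0 -> forall r X Y, proper_subst r ->
  instance_arrow G0 E a G B C X Y -> instance_arrow G0 E a G B C (tsubst r X) (tsubst r Y).
Proof.
  intros H0 r X Y Hr (s & Hs & -> & -> & Has).
  exists (fun n => tsubst r (s n)). repeat split.
  - intros n. now apply proper_tsubst.
  - apply tsubst_tsubst.
  - apply tsubst_tsubst.
  - intros j F HF. rewrite <- tsubst_tsubst.
    rewrite <- (map_tsubst_closed r G0) at 2 by assumption.
    apply bt_tsubst; auto.
Qed.

(** Only quantifier introductions can follow the abstraction rule in such a derivation; [G'] is [G]
    shifted once for each of them. *)
Lemma typing0_lam_inv G u A : typing false G (lam u) A -> Forall proper G ->
  exists G' B C, length G' = length G /\ Forall proper (B :: G') /\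
    typing false (B :: G') u C /\
    forall G0 E a s, closed_ctx G0 -> proper_subst s -> args_typed G0 E a G s ->
      arrow_inv (instance_arrow G0 E a G' B C) (tsubst s (starO A)).
Proof.
  intros H. remember (lam u) as t eqn:Et.
  induction H as [G n A Hn|G B C t HB Ht IH|G t v B C Hu IHu Hv IHv|G t A Hf Ht IH
    |G t A C He HC Ht IH]; intros HG; try discriminate.
  - injection Et as ->. exists G, B, C. repeat split; auto.
    intros G0 E a s H0 Hs Has. simpl. exists s; auto.
  - destruct (IH Et (Forall_proper_shift _ HG)) as (G' & B & C & HL & HP & Hu & Hinv).
    rewrite length_map in HL. exists G', B, C. repeat split; auto.
    intros G0 E a s H0 Hs Has. simpl.
    apply Hinv; auto using proper_subst_tup, args_typed_shift.
Qed.

Lemma bt_box_lam_inv G0 E i b u : closed_ctx G0 -> length G0 = 1 -> wf_env E ->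
  nth_error E i = Some b -> box_term b = lam u ->
  exists G' B C, length G' = length (box_ctx b) /\ Forall proper (B :: G') /\
    typing false (B :: G') u C /\
    forall A, btyping G0 E G0 (var (S i)) A ->
      arrow_inv (instance_arrow G0 E (box_arg b) G' B C) A.
Proof.
  intros H0 HL HE Hb Hu. destruct (HE i b Hb) as (_ & Ht & HG & _). rewrite Hu in Ht.
  destruct (typing0_lam_inv _ _ _ Ht HG) as (G' & B & C & HL' & HP & Hu' & Hinv).
  exists G', B, C. repeat split; auto. intros A H.
  remember G0 as G eqn:EG in H at 2. remember (var (S i)) as t eqn:Et.
  induction H as [G n A Hn|G k b' r Hi Hr Ha IHa|G F F' t HF Ht' IH|G t v F F' Hu1 IHu Hv IHv
    |G t A Hf Ht' IH|G t A F HF Ht' IH]; try discriminate; subst G.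
  - injection Et as ->. assert (S i < length G0) by (apply nth_error_Some; now rewrite Hn). lia.
  - injection Et as Ek. rewrite HL in Ek. simpl in Ek. injection Ek as ->.
    rewrite Hb in Hi. injection Hi as <-. now apply Hinv.
  - rewrite map_trename_closed in IH by assumption. simpl; auto.
  - specialize (IH eq_refl Et). simpl in IH. apply arrow_inv_tsubst; auto.
    + intros; now apply instance_arrow_tsubst.
    + apply proper_subst_scons; [assumption|]. now intros n.
Qed.

(** A boxed abstraction applied to [c] becomes a box for the body, with [c] recorded as the value of
    index 0. Its type always shows an arrow below its quantifiers, so it cannot be [O]. *)
Lemma unfold_lam G0 E i b u c : closed_ctx G0 -> length G0 = 1 -> wf_env E ->
  nth_error E i = Some b -> box_term b = lam u ->
  (forall n, free n c -> n <= length E) ->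
  exists b', wf_env (E ++ [b']) /\
    ~ btyping G0 E G0 (var (S i)) tO /\
    (forall A, btyping G0 E G0 (app (var (S i)) c) A ->
       btyping G0 (E ++ [b']) G0 (var (S (length E))) A) /\
    (forall P rho s u', realizes P E rho -> P u' u ->
       (forall j, j < length (box_ctx b) -> s j = subst rho (box_arg b j)) ->
       exists rho', (forall n, n <= length E -> rho' n = rho n) /\
         realizes P (E ++ [b']) rho' /\
         rho' (S (length E)) = subst (scons (subst rho c) s) u').
Proof.
  intros H0 HL HE Hb Hu Hc.
  destruct (bt_box_lam_inv G0 E i b u H0 HL HE Hb Hu) as (G' & B & C & HL' & HP & Hu' & Hinv).
  assert (Hi : i < length E) by (apply nth_error_Some; now rewrite Hb).
  destruct (HE i b Hb) as (Hn & _ & _ & Hfr). rewrite Hu in Hn.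
  set (b' := Box u (scons c (box_arg b)) (B :: G') C).
  assert (Hb' : wf_box (length E) b').
  { repeat split; simpl; auto. intros [|j] n Hj Hfn; simpl in Hfn; [auto|].
    assert (n <= i) by (apply (Hfr j n); [lia|assumption]). lia. }
  exists b'. split; [|split; [|split]].
  - now apply wf_env_snoc.
  - intros H. exact (Hinv _ H).
  - intros A H.
    remember G0 as G eqn:EG in H at 2. remember (app (var (S i)) c) as t eqn:Et.
    induction H as [G n A Hn'|G k b1 r Hi' Hr Ha IHa|G F F' t HF Ht' IH|G t v F F' Hu1 IHu Hv IHv
      |G t A Hf Ht' IH|G t A F HF Ht' IH]; try discriminate; subst G.
    + injection Et as -> ->. apply Hinv in Hu1. destruct Hu1 as (s & Hs & -> & -> & Has).
      replace (S (length E)) with (length G0 + length E) by lia.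
      apply (bt_box G0 _ G0 _ b' s); [apply nth_error_snoc|assumption|].
      intros [|j] F HF; simpl in *; apply bt_env_app; [injection HF as <-; assumption|].
      now apply Has.
    + rewrite map_trename_closed in IH by assumption.
      apply bt_alli; [assumption|]. rewrite map_trename_closed by assumption. auto.
    + apply bt_alle; auto.
  - intros P rho s u' HR HP' Hs.
    destruct (realizes_snoc P E rho b' (subst (scons (subst rho c) s) u') HE Hb' HR)
      as (rho' & Hag & Ev & HR').
    { exists (scons (subst rho c) s), u'. repeat split; auto.
      intros [|j] Hj; simpl in *; [reflexivity|]. apply Hs. lia. }
    exists rho'. auto.
Qed.

(** * Evaluation of [T x f] *)

(** Only proper types are formed, so a quantifier cannot be introduced over the closed type
    [D -> O]; hence none can be eliminated either. *)
Lemma bt_continuation D E A : closed_ty D ->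
  btyping [arrow D tO] E [arrow D tO] (var 0) A -> A = arrow D tO.
Proof.
  intros HD H.
  assert (H0 : closed_ctx [arrow D tO]).
  { constructor; [|constructor]. intros k [Hk|[]]. exact (HD k Hk). }
  remember [arrow D tO] as G eqn:EG in H at 2. remember (var 0) as t eqn:Et.
  induction H as [G n A Hn|G k b r Hi Hr Ha IHa|G F F' t HF Ht IH|G t v F F' Hu IHu Hv IHv
    |G t A Hf Ht IH|G t A F HF Ht IH]; try discriminate; subst G.
  - injection Et as ->. now injection Hn.
  - simpl in Et. discriminate.
  - rewrite map_trename_closed in IH by assumption. rewrite (IH eq_refl Et) in Hf.
    destruct Hf as [Hf|[]]. elim (HD 0 Hf).
  - discriminate (IH eq_refl Et).
Qed.

Lemma bt_continuation_app D E c A : closed_ty D ->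
  btyping [arrow D tO] E [arrow D tO] (app (var 0) c) A ->
  A = tO /\ btyping [arrow D tO] E [arrow D tO] c D.
Proof.
  intros HD H.
  assert (H0 : closed_ctx [arrow D tO]).
  { constructor; [|constructor]. intros k [Hk|[]]. exact (HD k Hk). }
  remember [arrow D tO] as G eqn:EG in H at 2. remember (app (var 0) c) as t eqn:Et.
  induction H as [G n A Hn|G k b r Hi Hr Ha IHa|G F F' t HF Ht IH|G t v F F' Hu IHu Hv IHv
    |G t A Hf Ht IH|G t A F HF Ht IH]; try discriminate; subst G.
  - injection Et as -> ->. apply bt_continuation in Hu; [|assumption].
    injection Hu as -> ->. auto.
  - rewrite map_trename_closed in IH by assumption.
    destruct (IH eq_refl Et) as [-> _]. elim Hf.
  - destruct (IH eq_refl Et) as [Habs _]. discriminate.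
Qed.


(** A derivation for a box variable is one use of [bt_box] followed by quantifier rules, which can
    be replayed on [w]. *)
Lemma bt_box_replace G0 E E' i b w : closed_ctx G0 -> length G0 = 1 ->
  nth_error E i = Some b ->
  (forall s, proper_subst s -> args_typed G0 E (box_arg b) (box_ctx b) s ->
     btyping G0 (E ++ E') G0 w (tsubst s (starO (box_ty b)))) ->
  forall A, btyping G0 E G0 (var (S i)) A -> btyping G0 (E ++ E') G0 w A.
Proof.
  intros H0 HL Hb Hw A H.
  remember G0 as G eqn:EG in H at 2. remember (var (S i)) as t eqn:Et.
  induction H as [G n A Hn|G k b' r Hi Hr Ha IHa|G F F' t HF Ht IH|G t v F F' Hu IHu Hv IHv
    |G t A Hf Ht IH|G t A F HF Ht IH]; try discriminate; subst G.
  - injection Et as ->. assert (S i < length G0) by (apply nth_error_Some; now rewrite Hn). lia.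
  - injection Et as Ek. rewrite HL in Ek. simpl in Ek. injection Ek as ->.
    rewrite Hb in Hi. injection Hi as <-. now apply Hw.
  - rewrite map_trename_closed in IH by assumption.
    apply bt_alli; [assumption|]. rewrite map_trename_closed by assumption. auto.
  - apply bt_alle; auto.
Qed.

(** Lexicographic induction on the strong normalization of the official run [t], then on the bound
    [m] for the head index. A visible redex or a boxed abstraction makes [t] perform a weak head
    step; a neutral box leaves [t] unchanged but brings a smaller variable to the head. The term
    [tau] is chosen before [rho], hence is common to all runs. *)
Lemma evaluation D t : closed_ty D -> SN t -> forall m E V rho0,
  let G0 := [arrow D tO] in
  head_index V < m -> t = subst rho0 V -> wf_env E -> realizes eq E rho0 ->
  btyping G0 E G0 V tO ->
  exists E' tau, wf_env E' /\ btyping G0 E' G0 tau D /\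
    forall rho, realizes std E rho -> exists rho', rho' 0 = rho 0 /\
      wh_red (subst rho V) (app (rho' 0) (subst rho' tau)).
Proof.
  intros HD St. induction St as [t _ IHt].
  induction m as [|m IHm]; intros E V rho0 G0 Hm Et HE HR HV; [lia|].
  assert (H0 : closed_ctx G0).
  { constructor; [|constructor]. intros k [Hk|[]]. exact (HD k Hk). }
  assert (HL : length G0 = 1) by reflexivity.
  assert (Hfree : forall n, free n V -> n <= length E).
  { intros n Hn. apply (bt_free _ _ _ _ _ HV) in Hn. simpl in Hn. lia. }
  destruct (spine_decomposition V) as (h & bs & -> & [[n ->]|[u ->]]).
  - assert (Hbs : forall k b, In b bs -> free k b -> k <= length E).
    { intros k b Hb Hk. apply Hfree, free_spine. eauto. }
    destruct n as [|i].
    (* The continuation has exactly one argument: without any its type would not be [O], and with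
       two the type [O] would have to be an arrow. *)
    + clear IHt IHm. destruct bs as [|c [|d bs]]; simpl in HV.
      * apply bt_continuation in HV; [discriminate|assumption].
      * apply bt_continuation_app in HV as [_ HV]; [|assumption].
        exists E, c. split; [assumption|]. split; [assumption|]. intros rho _. exists rho.
        split; [reflexivity|apply rt_refl].
      * apply bt_spine_inv in HV as [B HV]; [|assumption].
        apply bt_app_inv in HV as (X & Y & HV & _); [|assumption].
        apply bt_continuation_app in HV as [HV _]; [discriminate|assumption].
    + assert (Hi : i < length E).
      { apply Hfree, free_spine. left; reflexivity. }
      destruct (nth_error E i) as [b|] eqn:Eb; [|apply nth_error_None in Eb; lia].
      destruct (HE i b Eb) as (Nb & Tb & Pb & Fb).
      assert (Hmap : forall rho rho' ds, (forall d, In d ds -> In d bs) ->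
        (forall n, n <= length E -> rho' n = rho n) ->
        map (subst rho') ds = map (subst rho) ds).
      { intros rho rho' ds Hds Hag. apply map_ext_in. intros d Hd.
        apply subst_ext_free. intros n Hn. apply Hag, (Hbs n d); auto. }
      destruct (is_lam (box_term b)) eqn:Elam.
      * destruct (box_term b) as [ | |u] eqn:Eu; try discriminate Elam.
        destruct bs as [|c bs].
        (* [var 0] is a dummy argument; only the impossibility of the type [O] is extracted. *)
        { destruct (unfold_lam G0 E i b u (var 0) H0 HL HE Eb Eu) as (_ & _ & Habs & _).
          - simpl. intros n <-. lia.
          - contradiction. }
        destruct (unfold_lam G0 E i b u c H0 HL HE Eb Eu) as (b' & HE' & _ & Ht & Hr).
        { intros n Hn. apply (Hbs n c); simpl; auto. }
        assert (HV' : btyping G0 (E ++ [b']) G0 (fold_left app bs (var (S (length E)))) tO)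
          by exact (bt_spine_head G0 E [b'] bs H0 (app (var (S i)) c) _ Ht tO HV).
        assert (Hstep : forall s rho rho' u',
          (forall n, n <= length E -> rho' n = rho n) ->
          rho' (S (length E)) = subst (scons (subst rho c) s) u' ->
          wh_step (fold_left app (map (subst rho) (c :: bs)) (subst s (lam u')))
                  (subst rho' (fold_left app bs (var (S (length E)))))).
        { intros s rho rho' u' Hag E2. rewrite subst_spine. simpl.
          rewrite E2, (Hmap rho rho' bs) by (simpl; auto).
          apply wh_step_spine. rewrite <- subst1_subst_up. apply wh_redex. }
        (* In the official run the box holds exactly [lam u], so [Hstep] is a genuine step of [t]
           and the outer induction hypothesis applies. *)
        destruct (HR i b Eb) as (s0 & u0 & Es0 & -> & Hs0). rewrite Eu in Es0.
        destruct (Hr eq rho0 s0 u HR eq_refl Hs0) as (rho0' & Hag0 & HR0 & Ev0).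
        pose proof (Hstep s0 rho0 rho0' u Hag0 Ev0) as Hst.
        rewrite <- Es0 in Hst.
        change (rho0 (S i)) with (subst rho0 (var (S i))) in Hst.
        rewrite <- subst_spine, <- Et in Hst.
        destruct (IHt _ (wh_step_beta _ _ Hst) _ _ _ rho0' (Nat.lt_succ_diag_r _)
          eq_refl HE' HR0 HV') as (E' & tau & HEt & Htau & Hred).
        exists E', tau. split; [assumption|]. split; [assumption|]. intros rho Hrho.
        destruct (Hrho i b Eb) as (s & u' & Es & Hu' & Hs). rewrite Eu in Hu'.
        apply std_lam_inv in Hu' as (u'' & Hw & Hu'').
        destruct (Hr std rho s u'' Hrho Hu'' Hs) as (rho1 & Hag1 & HR1 & Ev1).
        destruct (Hred rho1 HR1) as (rho' & Er & Hred').
        exists rho'. split; [rewrite Er; apply Hag1; lia|].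
        (* Any other run first reduces its hidden term to an abstraction and then performs the same
           contraction. *)
        rewrite subst_spine. eapply rt_trans; [|eapply rt_trans; [apply rt_step|exact Hred']].
        -- apply wh_red_spine. simpl. rewrite Es. apply wh_red_subst, Hw.
        -- now apply Hstep.
      * destruct (unfold_neutral G0 (box_ctx b) (box_term b) (box_ty b) H0 HL Tb Nb Elam Pb
          E (box_arg b) HE) as (N & w & HE' & Tw & (j & Hj & Ew) & Fw & Rw).
        { intros j n Hj Hn. specialize (Fb j n Hj Hn). lia. }
        assert (Hhead : forall A, btyping G0 E G0 (var (S i)) A -> btyping G0 (E ++ N) G0 w A).
        { exact (bt_box_replace G0 E N i b w H0 HL Eb Tw). }
        assert (HV' : btyping G0 (E ++ N) G0 (fold_left app bs w) tO)
          by (revert HV; apply bt_spine_head; assumption).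
        assert (Hsub : forall s rho rho' u', (forall n, n <= length E -> rho' n = rho n) ->
          subst rho' w = subst s u' ->
          fold_left app (map (subst rho) bs) (subst s u') = subst rho' (fold_left app bs w)).
        { intros s rho rho' u' Hag E2. rewrite subst_spine, E2, (Hmap rho rho' bs); auto. }
        destruct (HR i b Eb) as (s0 & u0 & Es0 & -> & Hs0).
        destruct (Rw eq rho0 s0 (box_term b) HR) as (rho0' & Hag0 & HR0 & Ev0); [|assumption|].
        { clear - Nb Elam. induction (box_term b) as [k|u IHu v _|u _]; [constructor| |discriminate].
          apply normal_app in Nb as (Lu & Nu & _). constructor; auto. }
        (* The new head comes from an argument recorded in box [i], whose variables are at most [i],
           whereas the old head was [S i]. *)
        assert (Hm' : head_index (fold_left app bs w) < m).
        { rewrite head_index_spine in *. simpl in Hm. rewrite Ew.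
          destruct (head_index_free (box_arg b j)) as [->|Hh]; [lia|].
          apply Fb in Hh; [lia|assumption]. }
        assert (Et' : t = subst rho0' (fold_left app bs w)).
        { rewrite Et, subst_spine, <- (Hsub s0 rho0 rho0' _ Hag0 Ev0). simpl. now rewrite Es0. }
        destruct (IHm _ _ rho0' Hm' Et' HE' HR0 HV') as (E' & tau & HEt & Htau & Hred).
        exists E', tau. split; [assumption|]. split; [assumption|]. intros rho Hrho.
        destruct (Hrho i b Eb) as (s & u' & Es & Hu' & Hs).
        apply std_neutral_inv in Hu' as (u'' & Hw & Hu''); [|assumption|assumption].
        destruct (Rw std rho s u'' Hrho Hu'' Hs) as (rho1 & Hag1 & HR1 & Ev1).
        destruct (Hred rho1 HR1) as (rho' & Er & Hred').
        exists rho'. split; [rewrite Er; apply Hag1; lia|].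
        eapply rt_trans; [|exact Hred'].
        rewrite subst_spine, <- (Hsub s rho rho1 u'' Hag1 Ev1).
        apply wh_red_spine. simpl. rewrite Es. apply wh_red_subst, Hw.
  - destruct bs as [|c bs].
    (* An abstraction standing alone would have type [O], for which [lam_inv] is [False]. *)
    + apply bt_lam_inv in HV; [contradiction|assumption].
    + simpl in HV. set (V' := fold_left app bs (subst1 c u)).
      assert (Hw : wh_step (fold_left app (c :: bs) (lam u)) V')
        by exact (wh_step_spine bs _ _ (wh_redex u c)).
      pose proof (wh_step_subst _ _ rho0 Hw) as Hst. rewrite <- Et in Hst.
      assert (HV' : btyping G0 E G0 V' tO)
        by (eapply bt_beta; [assumption|exact HV|apply wh_step_beta, Hw]).
      destruct (IHt _ (wh_step_beta _ _ Hst) _ _ _ rho0 (Nat.lt_succ_diag_r _)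
        eq_refl HE HR HV') as (E' & tau & HEt & Htau & Hred).
      exists E', tau. split; [assumption|]. split; [assumption|]. intros rho Hrho.
      destruct (Hred rho Hrho) as (rho' & Er & Hred').
      exists rho'. split; [assumption|]. eapply rt_trans; [|exact Hred'].
      apply rt_step, wh_step_subst, Hw.
Qed.

Theorem theorem4p2 (D : ty) (T : term) :
  syntactical_data_type D ->
  ~ const_occ cbot D ->
  closed_term T ->
  typF [] T (arrow (star D) (neg (neg D))) ->
  storage_operator T D.
Proof.
  intros [(PD & CD & Hin) (_ & _ & HO & Hout)] Hbot CT HT t Ht.
  apply (typing_map_const bot_to_O) in HT. simpl in HT.
  rewrite map_const_star, (map_const_bot_to_O D Hbot) in HT by assumption.
  change (typing true [] T (arrow (starO D) (arrow (arrow D tO) tO))) in HT.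
  destruct (SN_normal_form t (typing_SN _ _ _ _ Ht)) as (t0 & Rt & Nt).
  assert (F0 : typing false [] t0 D).
  { apply Hin; [assumption|]. eapply typF_reds; eassumption. }
  set (G0 := [arrow D tO]).
  (* [t0] is typed in the empty context, so the argument map is a dummy. In [V], variable 0 is the
     continuation and variable 1 this box. *)
  set (b := Box t0 (fun _ => var 0) [] D).
  set (V := app (app T (var 1)) (var 0)).
  assert (HE : wf_env [b]).
  { intros [|[|i]] c Hc; try discriminate. injection Hc as <-.
    repeat split; simpl; auto. intros; lia. }
  assert (HV : btyping G0 [b] G0 V tO).
  { apply bt_app with (arrow D tO); [|now apply bt_var].
    apply bt_app with (starO D); [exact (typing_bt _ G0 [b] G0 _ _ _ HT)|].
    rewrite <- (tsubst_tvar (starO D)).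
    apply (bt_box G0 [b] G0 0 b tvar); [reflexivity|now intros n|].
    intros [|j]; discriminate. }
  assert (HVr : forall rho, subst rho V = app (app T (rho 1)) (rho 0)).
  { intros rho. simpl. now rewrite (subst_closed T rho CT). }
  assert (Hreal : forall P theta r, P theta t0 -> realizes P [b] (scons r (fun _ => theta))).
  { intros P theta r HP [|[|i]] c Hc; try discriminate. injection Hc as <-.
    exists var, theta. rewrite subst_var. repeat split; auto. simpl; intros; lia. }
  (* The official run puts [t0] itself in the box. It has type [starO D] by [typing0_starO], so the
     whole term is typable and strongly normalizing. *)
  assert (HSN : SN (subst (scons (var 0) (fun _ => t0)) V)).
  { rewrite HVr. simpl. apply (typing_SN true G0 _ tO).
    apply ty_app with (arrow D tO); [|now apply ty_ax].
    apply ty_app with (starO D).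
    - apply (bt_typing []). exact (typing_bt _ [] [] G0 _ _ _ HT).
    - apply (bt_typing []). exact (typing_bt _ [] [] G0 _ _ _ (typing0_starO true _ _ _ F0)). }
  destruct (evaluation D _ CD HSN _ [b] V _ (Nat.lt_succ_diag_r _) eq_refl HE
    (Hreal eq t0 _ eq_refl) HV) as (E & tau & HE' & Htau & Heval).
  (* Variable 0 has type [D -> O] and takes one argument; [S i] is box [i]. The value 0 beyond the
     boxes is a default. *)
  set (arity := fun n => match n with
    | 0 => 1
    | S i => match nth_error E i with Some c => star_arity (box_ty c) | None => 0 end
    end).
  set (s := fun n => const_lam (arity n) 0).
  assert (Hs : typF [tO] (subst s tau) D).
  { apply (bt_typing []).
    apply (bt_close G0 E G0 _ _ (wf_env_proper E HE') Htau _ _ 0); [reflexivity| |].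
    - intros [|[|n]] B HB; try discriminate. injection HB as <-.
      apply bt_abs; [assumption|]. now apply bt_var.
    - intros i c Hc. unfold s. simpl. now rewrite Hc. }
  (* [tau] contains boxes, so its strong normalization is drawn from its typable instance
     [subst s tau]. *)
  destruct (SN_normal_form tau (SN_subst_inv s tau (typing_SN _ _ _ _ Hs))) as (tau' & Rtau & Ntau).
  assert (Hs' : typF [tO] (subst s tau') D)
    by (eapply typF_reds; [apply reds_subst|]; eassumption).
  (* Here [s] sends every variable to a function constantly equal to the variable 0 of type [O]. A
     free variable of [tau'] would leave that variable free in a normal form of type [D],
     contradicting the output property. *)
  assert (Ctau : forall n, ~ free n tau').
  { destruct (normal_subst_const_lam tau' s 0 Ntau) as (n' & Nn & Rn & _ & Fn).
    { intros m. right. eexists; reflexivity. }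
    intros n Hn. apply (Hout n' Nn); [eapply typF_reds; eassumption|].
    eapply Fn; [exact Hn|reflexivity]. }
  rewrite (subst_closed tau' s Ctau) in Hs'.
  exists tau, tau'. split; [now apply reds_beta_eq|]. split.
  - apply (typing_ext_free _ _ _ _ Hs'). intros n B Hn. elim (Ctau n Hn).
  - intros theta Htheta f _ _.
    assert (Hstd : std theta t0).
    { apply reds_std, beta_eq_normal; [assumption|].
      eapply rst_trans; [exact Htheta|]. now apply reds_beta_eq. }
    destruct (Heval _ (Hreal std theta (var f) Hstd)) as (rho' & Er & Hred).
    exists rho'. rewrite HVr, Er in Hred. exact Hred.
Qed.
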